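(* Let $\mathcal{C}$ be the family of Euclidean lines in the unit disk (i.e. all closed chords of $\partial\mathbb{D}^2$), let $P\subset\mathbb{D}^2$ be a convex polygon, and let $d$ be the metric on $P$ constructed from a set $\Theta=\{\theta_i\}_{i\in\mathbb{N}}$ and weights $(w_i)_{i\in\mathbb{N}}$ as described in the context. Then for any convex domain $U$ in $\mathbb{R}^2$ equipped with its Hilbert metric $d_{\mathcal{H}}$, the metric spaces $(P,d)$ and $(U,d_{\mathcal{H}})$ are not isometric.
   Context: $\mathbb{D}^2$ is the open unit disk in $\mathbb{R}^2$ and $\partial\mathbb{D}^2$ its boundary circle. For distinct $\xi,\eta\in\partial\mathbb{D}^2$, $(\xi,\eta)$ is the chord with these endpoints. A convex polygon is a nonempty open convex subset $P\subset\mathbb{D}^2$ whose boundary $\partial P$ is a finite union of Euclidean segments with endpoints in $\mathbb{D}^2$ (its sides). For $x\in\mathbb{D}^2$, $\theta\in\partial\mathbb{D}^2$, $x_\theta\in\partial\mathbb{D}^2$ denotes the second endpoint of the chord through $x$ with endpoint $\theta$. For each $\theta\in\partial\mathbb{D}^2$ there are unique points $\xi_\theta,\eta_\theta\in\partial\mathbb{D}^2$ such that the region bounded by the chords $(\theta,\xi_\theta)$, $(\theta,\eta_\theta)$ and the arc of $\partial\mathbb{D}^2$ from $\xi_\theta$ to $\eta_\theta$ not containing $\theta$ contains $P$ and is minimal with this property; they are labelled so that $\theta,\eta_\theta,\xi_\theta$ are in clockwise cyclic order. For points $a,b$ in the arc between $\eta_\theta$ and $\xi_\theta$ not containing $\theta$,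 $|ab|$ is the Euclidean length of the subarc between $a$ and $b$ not containing $\theta$. For $x,y\in P$, named so that the clockwise order is $\eta_\theta,y_\theta,x_\theta,\xi_\theta$ (with $x_\theta=y_\theta$ allowed), $$d_\theta(x,y):=\log\frac{|\eta_\theta x_\theta|\,|\xi_\theta y_\theta|}{|\eta_\theta y_\theta|\,|\xi_\theta x_\theta|}.$$ $\Theta=\{\theta_i\mid i\in\mathbb{N}\}$ is a countable dense subset of $\partial\mathbb{D}^2$ such that for each side $[v,w]$ of $P$ both endpoints of the chord containing $[v,w]$ belong to $\Theta$; $w_i>0$ are reals with $\sum_i w_i<\infty$; and $d(x,y):=\sum_{i=1}^\infty w_i\,d_{\theta_i}(x,y)$ for $x,y\in P$; this is a metric on $P$. Hilbert metric: for a nonempty open convex set $U\subset\mathbb{R}^2$ containing no full affine line (so that the following is a metric) and distinct $p,q\in U$, let the line through $p,q$ meet $\partial U$ at $a,b$ with $a,p,q,b$ in this order; then $d_{\mathcal{H}}(p,q)=\log\frac{|a-q|\,|b-p|}{|a-p|\,|b-q|}$, where if $a$ (resp. $b$) is at infinity the ratio $|a-q|/|a-p|$ (resp. $|b-p|/|b-q|$) is replaced by $1$; $d_{\mathcal{H}}(p,p)=0$. *)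

(* Defs.v *)
From HB Require Import structures.
From mathcomp Require Import all_boot all_order all_algebra.
From mathcomp Require Import all_classical all_reals all_analysis.

Set Implicit Arguments.
Unset Strict Implicit.
Unset Printing Implicit Defensive.
Import Order.TTheory GRing.Theory Num.Theory.
Import numFieldNormedType.Exports.

Local Open Scope classical_set_scope.
Local Open Scope ring_scope.

Section Definitions.
Variable R : realType.

(* The library norm on R * R is the sup norm (with the same topology). *)
Definition edist (p q : R * R) : R :=
  Num.sqrt ((p.1 - q.1) ^+ 2 + (p.2 - q.2) ^+ 2).

Definition unit_disk : set (R * R) := [set x | edist x 0 < 1].
Definition unit_circle : set (R * R) := [set x | edist x 0 = 1].

Definition boundary (A : set (R * R)) : set (R * R) := closure A `\` A°.

Definition segment (a b : R * R) : set (R * R) :=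
  [set x | exists2 t : R, 0 <= t <= 1 & x = a + t *: (b - a)].

Definition convex_polygon (P : set (R * R)) (sides : seq ((R * R) * (R * R))) :=
  [/\ P !=set0, open P, convex_set P & P `<=` unit_disk] /\
  [/\ forall s, s \in sides ->
        [/\ unit_disk s.1, unit_disk s.2 & s.1 <> s.2]
    & boundary P = [set x | exists2 s, s \in sides & segment s.1 s.2 x]].

Definition rotate (t : R) (p : R * R) : R * R :=
  (cos t * p.1 - sin t * p.2, sin t * p.1 + cos t * p.2).

(* Length, in [0, 2 pi[, of the counterclockwise arc of the unit circle from a
   to b. *)
Definition ccw_length (a b : R * R) : R :=
  get [set t : R | 0 <= t < 2 * pi /\ b = rotate t a].

Definition clockwise (a b c : R * R) :=
  0 < ccw_length a c < ccw_length a b.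

(* For a, b different from theta on the circle: the closed arc between a and b
   not containing theta, and the length |ab| of that arc. *)
Definition arc_avoiding (theta a b : R * R) : set (R * R) :=
  [set c | unit_circle c /\
    Num.min (ccw_length theta a) (ccw_length theta b) <= ccw_length theta c
      <= Num.max (ccw_length theta a) (ccw_length theta b)].

Definition arc_length (theta a b : R * R) : R :=
  `|ccw_length theta a - ccw_length theta b|.

Definition chord (a b : R * R) : set (R * R) := segment a b.

Definition second_endpoint (theta x : R * R) : R * R :=
  get [set y | [/\ unit_circle y, y <> theta & chord theta y x]].

(* The closed region bounded by the chords (theta, xi), (theta, eta) and the
   arc from xi to eta, as the union of the chords joining theta to the arc. *)
Definition region (theta xi eta : R * R) : set (R * R) :=
  [set x | exists2 c, arc_avoiding theta xi eta c & chord theta c x].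

Definition off_theta (theta a : R * R) := unit_circle a /\ a <> theta.

Definition minimal_region (P : set (R * R)) (theta xi eta : R * R) :=
  P `<=` region theta xi eta /\
  forall xi' eta', off_theta theta xi' -> off_theta theta eta' ->
    P `<=` region theta xi' eta' ->
    region theta xi' eta' `<=` region theta xi eta ->
    region theta xi' eta' = region theta xi eta.

Definition xi_eta (P : set (R * R)) (theta : R * R) : (R * R) * (R * R) :=
  get [set p | [/\ off_theta theta p.1, off_theta theta p.2,
                   minimal_region P theta p.1 p.2
                 & clockwise theta p.2 p.1]].

Definition xi (P : set (R * R)) (theta : R * R) : R * R := (xi_eta P theta).1.
Definition eta (P : set (R * R)) (theta : R * R) : R * R := (xi_eta P theta).2.

Definition log_ratio (P : set (R * R)) (theta x y : R * R) : R :=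
  let xt := second_endpoint theta x in
  let yt := second_endpoint theta y in
  ln ((arc_length theta (eta P theta) xt * arc_length theta (xi P theta) yt) /
      (arc_length theta (eta P theta) yt * arc_length theta (xi P theta) xt)).

(* The test says that eta_theta, y_theta, x_theta, xi_theta are met in this
   order clockwise from theta; otherwise the two points are renamed. *)
Definition d_theta (P : set (R * R)) (theta x y : R * R) : R :=
  if ccw_length theta (second_endpoint theta x)
     <= ccw_length theta (second_endpoint theta y)
  then log_ratio P theta x y else log_ratio P theta y x.

Definition polygon_dist (P : set (R * R)) (theta : nat -> R * R) (w : nat -> R)
    (x y : R * R) : R :=
  limn (series (fun i => w i * d_theta P (theta i) x y)).

Definition side_chords_in (Theta : set (R * R))
    (sides : seq ((R * R) * (R * R))) :=
  forall s, s \in sides -> forall a b, unit_circle a -> unit_circle b ->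
    a <> b -> segment s.1 s.2 `<=` chord a b -> Theta a /\ Theta b.

Definition convex_domain (U : set (R * R)) :=
  [/\ U !=set0, open U, convex_set U
    & forall p v : R * R, v <> 0 -> ~ (forall t : R, U (p + t *: v))].

(* The points b of the boundary such that p, q, b lie on a line in this order.
   For distinct p, q in an open convex U there is at most one; if there is
   none, the corresponding end of the line is at infinity. *)
Definition boundary_beyond (U : set (R * R)) (p q : R * R) : set (R * R) :=
  [set b | boundary U b /\ exists2 t : R, 1 < t & b = p + t *: (q - p)].

Definition end_ratio (U : set (R * R)) (p q : R * R) : R :=
  if `[< boundary_beyond U p q !=set0 >] then
    let b := get (boundary_beyond U p q) in edist b p / edist b q
  else 1.

Definition hilbert_dist (U : set (R * R)) (p q : R * R) : R :=
  if p == q then 0 else ln (end_ratio U q p * end_ratio U p q).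

Definition isometric (A : set (R * R)) (dA : R * R -> R * R -> R)
    (B : set (R * R)) (dB : R * R -> R * R -> R) :=
  exists f : R * R -> R * R, set_bij A B f /\
    forall x y, A x -> A y -> dB (f x) (f y) = dA x y.

End Definitions.

(* Main.v *)
Require Import Defs.
From mathcomp Require Import all_boot all_order all_algebra.
From mathcomp Require Import all_classical all_reals all_analysis.
From mathcomp Require Import ring lra.
Import Order.TTheory GRing.Theory Num.Theory.
Import numFieldNormedType.Exports.
Local Open Scope classical_set_scope.
Local Open Scope ring_scope.

Set Implicit Arguments.
Unset Strict Implicit.
Unset Printing Implicit Defensive.

(* Both metrics are controlled by affine functionals.  For the Hilbert metric,
   exp (hilbert_dist p q) is the product of the maxima of l p / l q and of
   l q / l p over the affine functionals l that are positive on U, and the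
   maximum is attained by the same "tight" functional all along a ray.  In
   (P, d) the segments are the only geodesics, since the theta_i are dense;
   hence an isometry f : P -> U maps segments to segments.  Two rays of P which
   end inside the same side of P can be followed at bounded distance, while d
   blows up along each of them because the ends of the chord of the side belong
   to the family theta.  The functional which is tight along the image of one
   of these rays is therefore tight along the image of the other.  Take x, y, z
   not aligned such that the lines through them all run from one side of P to
   another one: then the same functional serves for the three images, so that
   d x z = d x y + d y z, although y is not on the segment from x to z. *)

(** * Convex sets and affine functionals *)

(** The obstacle is that little is known about the shape of [U]: it may be unbounded, its geodesics
    need not be unique, and no extension of [f] to the boundary is available. So the ends of the
    image rays are never named; functionals positive on [U] are compared at interior points, where a
    bound on the Hilbert distance bounds the ratio of their values. The Hilbert distance has one
    factor for each direction of travel, hence two sides of [P] are used: one for the functional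
    from [x] to [z], one for the way back.

    On [P], the link with affine functionals is the cotangent of the angle seen from [theta i]: it
    is a quotient of affine functions whose denominator lies between [1 - r] and [2] once [P] is in
    a disk of radius [r < 1]. Hence comparability of affine functionals at two points bounds all the
    [d_theta] by a constant independent of [i], and summability of the weights bounds [d]. For the
    divergence a single term suffices, that of an end of the chord of the side. *)

Ltac pt_eq tac :=
  apply: injective_projections; rewrite /= /GRing.scale /=; tac.

Section PlaneVectors.
Variable R : realType.
Implicit Types (n u v : R * R).

Definition dot u v : R := u.1 * v.1 + u.2 * v.2.
Definition crossp u v : R := u.1 * v.2 - u.2 * v.1.

Lemma dot_gt0 n : n <> 0 -> 0 < dot n n.
Proof.
move=> n0; rewrite lt_neqAle addr_ge0 -?expr2 ?sqr_ge0 // andbT eq_sym.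
rewrite /dot -!expr2 paddr_eq0 ?sqr_ge0 // !sqrf_eq0.
by apply/negP => /andP[/eqP e1 /eqP e2]; apply/n0/injective_projections.
Qed.

End PlaneVectors.

Section ConvexSets.
Variable R : realType.
Implicit Types (A : set (R * R)) (p q u v b : R * R) (l m : R * R -> R).

Definition is_affine l :=
  forall u v t, l (u + t *: (v - u)) = l u + t * (l v - l u).

Lemma convex_lerp A u v (t : R) : convex_set A -> A u -> A v ->
  0 <= t <= 1 -> A (u + t *: (v - u)).
Proof.
move=> cA Au Av t01.
case/andP: t01 => t0 t1.
have := cA v u (Itv01 t0 t1); rewrite !inE => /(_ Av Au).
rewrite -[X in A X -> _]/(t *: v + (1 - t) *: u).
by congr (A _); pt_eq ltac:(ring).
Qed.

Lemma open_near_line A p v : open A -> A p ->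
  exists2 e : R, 0 < e & forall s, `|s| <= e -> A (p + s *: v).
Proof.
move=> oA Ap.
have : \forall s \near (0 : R), A (p + s *: v).
  have : (p + s *: v) @[s --> (0 : R)] --> p + 0 *: v.
    by apply: cvgD; [exact: cvg_cst|apply: cvgZr_tmp; exact: cvg_id].
  rewrite scale0r addr0; apply; exact: open_nbhs_nbhs.
move=> /nbhs_ballP[e /= e0 eA]; exists (e / 2); first lra.
move=> s se; apply: eA; rewrite /ball /= sub0r normrN; lra.
Qed.

Lemma open_extend A p q : open A -> A p ->
  exists2 t : R, 0 < t & A (p + t *: (p - q)).
Proof.
move=> oA Ap; have [e e0 eA] := open_near_line (p - q) oA Ap.
by exists e => //; apply: eA; rewrite gtr0_norm.
Qed.

(** For [c] in [A] close enough to [b], the point [p + (s / (1 - s)) *: (b - c)] is still in [A];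
    the target divides the segment from it to [c] in the ratio given by [s]. *)
Lemma interior_closure A p b (s : R) : open A -> convex_set A -> A p ->
  closure A b -> 0 <= s < 1 -> A (p + s *: (b - p)).
Proof.
move=> oA cA Ap clb /andP[s0 s1].
have near_b : \forall c \near b, A (p + (s / (1 - s)) *: (b - c)).
  have : (p + (s / (1 - s)) *: (b - c)) @[c --> b] -->
         p + (s / (1 - s)) *: (b - b).
    apply: cvgD; first exact: cvg_cst.
    by apply: cvgZl_tmp; apply: cvgB; [exact: cvg_cst|exact: cvg_id].
  rewrite subrr scaler0 addr0; apply; exact: open_nbhs_nbhs.
have [c [Ac Agc]] := clb _ near_b.
rewrite /= in Agc.
have s01 : 0 <= s <= 1 by rewrite s0 ltW.
have := convex_lerp cA Agc Ac s01; congr (A _).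
have ? : 1 - s != 0 by rewrite subr_eq0; apply/eqP => ?; lra.
by pt_eq ltac:(field).
Qed.

(* The inverse [a] of the length of a ray, so that [a = 0] encodes an
   infinite ray. *)
Lemma ray_gauge A p v : open A -> convex_set A -> A p ->
  exists2 a : R, 0 <= a & forall s, 0 <= s -> (A (p + s *: v) <-> a * s < 1).
Proof.
move=> oA cA Ap; pose T := [set s : R | 0 <= s /\ A (p + s *: v)].
have T0 : T 0 by split=> //; rewrite scale0r addr0.
have Tdown s t : 0 <= s <= t -> T t -> T s.
  move=> /andP[s0 st] [t0 At]; split=> //.
  have [t00|tn0] := eqVneq t 0.
    have s00 : s = 0 by lra.
    by rewrite s00 scale0r addr0.
  have st1 : 0 <= s / t <= 1.
    by rewrite divr_ge0 //= ler_pdivrMr ?mul1r // lt_neqAle eq_sym tn0.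
  by have := convex_lerp cA Ap At st1; congr (A _); pt_eq ltac:(field).
have Topen t : T t -> exists2 e, 0 < e & T (t + e).
  move=> [t0 At]; have [e e0 eA] := open_near_line v oA At.
  exists e => //; split; first lra.
  have := eA e; rewrite gtr0_norm // => /(_ (lexx _)).
  by congr (A _); pt_eq ltac:(ring).
have [ubT|nubT] := pselect (has_ubound T); last first.
  exists 0 => // s s0; rewrite mul0r; split=> // _.
  suff [t Tt st] : exists2 t, T t & s <= t by apply: (Tdown s t _ Tt).2; lra.
  apply: contrapT => nT; apply: nubT; exists s => t Tt.
  by rewrite leNgt; apply/negP => st; apply: nT; exists t => //; exact: ltW.
have supT : has_sup T by split=> //; exists 0.
have sup0 : 0 < sup T.
  by have [e e0 Te] := Topen _ T0; rewrite (lt_le_trans e0) // -[e]add0r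
    (ub_le_sup ubT).
exists (sup T)^-1; first by rewrite invr_ge0 ltW.
move=> s s0; rewrite ltr_pdivrMl // mulr1; split=> [As|sT].
  have [e e0 Te] := Topen s (conj s0 As).
  by rewrite (@lt_le_trans _ _ (s + e)) ?ltrDl // (ub_le_sup ubT).
have d0 : 0 < sup T - s by lra.
have [t Tt st] := sup_adherent d0 supT.
by apply: (Tdown s t _ Tt).2; lra.
Qed.

Lemma gauge_boundary A p v (a : R) : open A -> 0 < a ->
  (forall s, 0 <= s -> (A (p + s *: v) <-> a * s < 1)) ->
  boundary A (p + a^-1 *: v).
Proof.
move=> oA ap gA; have ai : 0 < a^-1 by rewrite invr_gt0.
split; last first.
  move=> /(interior_subset) /gA => /(_ (ltW ai)).
  by rewrite mulfV ?ltxx // gt_eqF.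
move=> B nB.
have : \forall s \near a^-1, B (p + s *: v).
  have : (p + s *: v) @[s --> a^-1] --> p + a^-1 *: v.
    by apply: cvgD; [exact: cvg_cst|apply: cvgZr_tmp; exact: cvg_id].
  exact.
move=> /nbhs_ballP[e /= e0 eB].
pose d := Num.min (e / 2) (a^-1 / 2).
have dlt : 0 < d by rewrite lt_min; apply/andP; split; lra.
have de : d <= e / 2 by rewrite ge_min lexx.
have da : d <= a^-1 / 2 by rewrite ge_min lexx orbT.
exists (p + (a^-1 - d) *: v); split.
  apply/gA; first lra.
  by rewrite mulrBr mulfV ?gt_eqF //; nra.
by apply: eB; rewrite /ball /= opprB addrC subrK gtr0_norm //; lra.
Qed.

Lemma affine_closure_ge0 A l b p : open A -> convex_set A -> A p ->
  is_affine l -> (forall u, A u -> 0 <= l u) -> closure A b -> 0 <= l b.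
Proof.
move=> oA cA Ap al l0 clb; rewrite leNgt; apply/negP => lb.
have lp := l0 _ Ap.
pose s := (l p - l b / 2) / (l p - l b).
have s01 : 0 <= s < 1.
  by rewrite /s divr_ge0 /= ?ltr_pdivrMr; lra.
have := l0 _ (interior_closure oA cA Ap clb s01).
rewrite al; apply/negP; rewrite -ltNge.
have -> : l p + s * (l b - l p) = l b / 2; last lra.
by rewrite /s; field; apply/eqP => ?; lra.
Qed.

Lemma affine_gt0 A l p : open A -> convex_set A -> A p -> is_affine l ->
  0 < l p -> (forall u, A u -> 0 <= l u) -> forall u, A u -> 0 < l u.
Proof.
move=> oA cA Ap al lp l0 u Au; rewrite lt_neqAle l0 // andbT eq_sym.
apply/eqP => lu; have [t t0 At] := open_extend p oA Au.
have := l0 _ At; have := al u p (- t).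
have -> : u + - t *: (p - u) = u + t *: (u - p) by pt_eq ltac:(ring).
by move=> ->; rewrite lu; nra.
Qed.

(** A Harnack inequality: [k] is uniform in [l] because it only records how far the line from [q]
    can be prolonged beyond [p] inside [A]. *)
Lemma affine_comparable A p q : open A -> A p ->
  exists2 k : R, 1 <= k & forall l, is_affine l ->
    (forall u, A u -> 0 <= l u) -> l q <= k * l p.
Proof.
move=> oA Ap; have [t t0 At] := open_extend q oA Ap.
exists ((1 + t) / t); first by rewrite ler_pdivlMr //; lra.
move=> l al l0; have := l0 _ At; have := al p q (- t).
have -> : p + - t *: (q - p) = p + t *: (p - q) by pt_eq ltac:(ring).
by move=> -> h; rewrite mulrAC ler_pdivlMr //; nra.
Qed.

End ConvexSets.

(** * The Hilbert metric through tight functionals *)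

Section HilbertMetric.
Variables (R : realType) (U : set (R * R)).
Hypotheses (oU : open U) (cU : convex_set U).
Implicit Types (p q X Y Z : R * R) (l m : R * R -> R).

Lemma edist_gt0 p q : p <> q -> 0 < Defs.edist p q.
Proof.
move=> pq; rewrite sqrtr_gt0 lt_neqAle addr_ge0 ?sqr_ge0 // andbT eq_sym.
rewrite paddr_eq0 ?sqr_ge0 // !sqrf_eq0 !subr_eq0.
apply/negP => /andP[/eqP p1 /eqP p2]; apply: pq.
exact: injective_projections.
Qed.

Lemma edist_scale (t : R) p q u v : p - q = t *: (u - v) ->
  Defs.edist p q = `|t| * Defs.edist u v.
Proof.
move=> /pair_equal_spec[] /=; rewrite /GRing.scale /= => e1 e2.
rewrite /Defs.edist e1 e2 !exprMn -mulrDr sqrtrM ?sqr_ge0 //.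
by rewrite sqrtr_sqr.
Qed.

(** The ray leaves [U] at parameter [T = a^-1], so the ratio of distances is [T / (T - 1)]; at
    [a = 0] the formula returns the conventional value 1 of an infinite ray. *)
Lemma end_ratio_gauge p q (a : R) : U p -> U q -> p <> q -> 0 <= a ->
  (forall s, 0 <= s -> (U (p + s *: (q - p)) <-> a * s < 1)) ->
  end_ratio U p q = (1 - a)^-1.
Proof.
move=> Up Uq pq a0 gU.
have a1 : a < 1.
  have /(gU _ ler01) : U (p + 1 *: (q - p)) by rewrite scale1r addrC subrK.
  by rewrite mulr1.
(* The exit point is unique: a boundary point with [a * t > 1] would, by convexity, put the exit
   point itself in [U]. *)
have atE t : 1 < t -> boundary U (p + t *: (q - p)) -> a * t = 1.
  move=> t1 [clt nUt].
  have t0 : 0 <= t by lra.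
  have : 1 <= a * t.
    rewrite leNgt; apply/negP => /(gU _ t0) Ut; apply: nUt.
    by rewrite /= (interior_id U).1.
  rewrite le_eqVlt => /predU1P[-> //|at1]; exfalso.
  have ap : 0 < a by nra.
  have s01 : 0 <= (a * t)^-1 < 1.
    by rewrite invr_ge0 mulr_ge0 //= invf_lt1 //; lra.
  have := interior_closure oU cU Up clt s01.
  have -> : p + (a * t)^-1 *: (p + t *: (q - p) - p) = p + a^-1 *: (q - p).
    by pt_eq ltac:(field; apply/andP; split; apply: lt0r_neq0; lra).
  by move/gU; rewrite invr_ge0 mulfV ?ltxx; [move/(_ a0)|apply: lt0r_neq0; lra].
have bdry : 0 < a -> boundary U (p + a^-1 *: (q - p)).
  by move=> ap; exact: gauge_boundary.
rewrite /end_ratio; case: asboolP => [ne|empty]; last first.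
  move: a0; rewrite le_eqVlt => /predU1P[<-|ap]; first by rewrite subr0 invr1.
  exfalso; apply: empty; exists (p + a^-1 *: (q - p)); split.
    exact: bdry.
  by exists a^-1 => //; rewrite invf_gt1.
have [bU [t t1 bE]] := getPex ne.
set b := get _ in bU bE *.
have at1 : a * t = 1 by apply: atE => //; rewrite -bE.
rewrite (@edist_scale t b p q p); last by rewrite bE addrC addKr.
rewrite (@edist_scale (t - 1) b q q p); last by rewrite bE; pt_eq ltac:(ring).
have := @edist_gt0 q p (fun e => pq (esym e)) => dpos.
rewrite !gtr0_norm; [|lra|lra].
have an0 : a != 0 by apply/eqP => a00; move: at1; rewrite a00 mul0r; lra.
have -> : a = t^-1 by apply: (mulIf (x := t)); [|rewrite mulVf //]; apply: lt0r_neq0; lra.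
by field; apply/and3P; split; apply: lt0r_neq0 => //; lra.
Qed.

(** If [l] decreases from [p] to [q], it vanishes at parameter [l p / (l p - l q)]; positivity on
    [U] forbids this before the exit point. *)
Lemma end_ratio_ub p q l : U p -> U q -> p <> q -> is_affine l ->
  (forall u, U u -> 0 < l u) -> l p / l q <= end_ratio U p q.
Proof.
move=> Up Uq pq al l0; have [a a0 gU] := ray_gauge (q - p) oU cU Up.
rewrite (end_ratio_gauge Up Uq pq a0 gU).
have lp := l0 _ Up; have lq := l0 _ Uq.
have a1 : a < 1.
  have /(gU _ ler01) : U (p + 1 *: (q - p)) by rewrite scale1r addrC subrK.
  by rewrite mulr1.
rewrite ler_pdivrMr // mulrC ler_pdivlMr ?subr_gt0 // leNgt; apply/negP => lt.
have d0 : 0 < l p - l q by nra.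
have s0 : 0 <= l p / (l p - l q) by apply: divr_ge0; lra.
have /gU : a * (l p / (l p - l q)) < 1 by rewrite mulrA ltr_pdivrMr //; lra.
move=> /(_ s0) /l0; rewrite al.
have -> : l p + l p / (l p - l q) * (l q - l p) = 0.
  by field; apply: lt0r_neq0; lra.
by rewrite ltxx.
Qed.

(** By the gauge formula, the equality says that [m] vanishes where the ray from [p] through [q]
    leaves [U], or is constant on an infinite ray: [m] is a supporting functional there. *)
Definition tight m p q := [/\ is_affine m, forall u, U u -> 0 < m u
  & end_ratio U p q = m p / m q].

Lemma on_line (u p v : R * R) : v <> 0 ->
  (u.2 - p.2) * v.1 - (u.1 - p.1) * v.2 = 0 ->
  u = p + (((u.1 - p.1) * v.1 + (u.2 - p.2) * v.2) /
           (v.1 ^+ 2 + v.2 ^+ 2)) *: v.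
Proof.
move=> v0 t0; set N := v.1 ^+ 2 + _; set s := (u.1 - p.1) * v.1 + _.
have N0 : N != 0.
  apply/eqP => /eqP; rewrite paddr_eq0 ?sqr_ge0 // !sqrf_eq0.
  by move=> /andP[/eqP v1 /eqP v2]; apply: v0; exact: injective_projections.
have e1 : N * (u.1 - p.1) = v.1 * s.
  by rewrite -[RHS]subr0 -(mulr0 v.2) -t0 /N /s; ring.
have e2 : N * (u.2 - p.2) = v.2 * s.
  by rewrite -[RHS]addr0 -(mulr0 v.1) -t0 /N /s; ring.
apply: injective_projections; rewrite /= /GRing.scale /=.
  by apply: (mulfI N0); rewrite -(subrK p.1 u.1) mulrDr e1; field.
by apply: (mulfI N0); rewrite -(subrK p.2 u.2) mulrDr e2; field.
Qed.

(* One step of the Hahn-Banach extension: the functional is prescribed on the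
   line through [p] and [q], and [k] is its slope in the normal direction. *)
Lemma tight_exists p q : U p -> U q -> p <> q -> exists m, tight m p q.
Proof.
move=> Up Uq pq; have [a a0 gU] := ray_gauge (q - p) oU cU Up.
pose v := q - p; pose N := v.1 ^+ 2 + v.2 ^+ 2.
have v0 : v <> 0 by move/eqP; rewrite subr_eq0 => /eqP /esym.
have N0 : 0 < N by have := dot_gt0 v0; rewrite /dot -!expr2.
(* Coordinates along [v] and across it, both scaled by the norm of [v]. The functional sought is
   [N - a * sg u + k * ta u]; at [p + s *: v] it equals [N * (1 - a * s)]. *)
pose sg u := (u.1 - p.1) * v.1 + (u.2 - p.2) * v.2.
pose ta u := (u.2 - p.2) * v.1 - (u.1 - p.1) * v.2.
(* Points on one side of the line bound [k] from below, points on the other side from above. These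
   bounds are compatible because the segment from [u] to [u'] crosses the line inside [U], where the
   prescribed values are nonnegative. *)
have sep u u' : U u -> U u' -> 0 < ta u -> ta u' < 0 ->
    (a * sg u - N) / ta u <= (N - a * sg u') / - ta u'.
  move=> Uu Uu' tu tu'.
  pose t := ta u / (ta u - ta u').
  have d0 : 0 < ta u - ta u' by lra.
  have t01 : 0 <= t <= 1.
    by rewrite /t divr_ge0 ?ler_pdivrMr //=; lra.
  have Uw := convex_lerp cU Uu Uu' t01.
  set w := u + t *: (u' - u) in Uw.
  have tw : ta w = 0.
    rewrite (_ : ta w = ta u + t * (ta u' - ta u)).
      by rewrite /t; field; apply: lt0r_neq0; lra.
    by rewrite /ta /w /= /GRing.scale /=; ring.
  have sw : (ta u - ta u') * sg w = - ta u' * sg u + ta u * sg u'.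
    rewrite (_ : sg w = sg u + t * (sg u' - sg u)).
      by rewrite /t; field; apply: lt0r_neq0; lra.
    by rewrite /sg /w /= /GRing.scale /=; ring.
  have wE : w = p + (sg w / N) *: v by apply: on_line.
  have asw : a * sg w <= N.
    have [s0|s0] := ltP (sg w) 0; first by nra.
    have : U (p + (sg w / N) *: v) by rewrite -wE.
    move/gU; rewrite divr_ge0 ?(ltW N0) // => /(_ isT).
    by rewrite mulrA ltr_pdivrMr // mul1r; lra.
  rewrite ler_pdivrMr // mulrAC ler_pdivlMr ?oppr_gt0 //.
  have : a * ((ta u - ta u') * sg w) <= N * (ta u - ta u') by nra.
  by rewrite sw; lra.
pose S := [set x | exists2 u, U u /\ 0 < ta u & x = (a * sg u - N) / ta u].
have [e e0 eU] := open_near_line ((- v.2, v.1) : R * R) oU Up.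
have taE s : ta (p + s *: (- v.2, v.1)) = s * N.
  by rewrite /ta /N /= /GRing.scale /=; ring.
have U1 : U (p + e *: (- v.2, v.1)) by apply: eU; rewrite gtr0_norm.
have U2 : U (p + (- e) *: (- v.2, v.1)) by apply: eU; rewrite normrN gtr0_norm.
have t1 : 0 < ta (p + e *: (- v.2, v.1)) by rewrite taE mulr_gt0.
have t2 : ta (p + (- e) *: (- v.2, v.1)) < 0 by rewrite taE mulNr oppr_lt0 mulr_gt0.
have S0 : S !=set0 by eexists; exists (p + e *: (- v.2, v.1)).
have ubS : has_ubound S.
  by eexists => x [u [Uu tu] ->]; exact: sep Uu U2 tu t2.
pose k := sup S.
pose m u := N - a * sg u + k * ta u.
have am : is_affine m.
  by move=> x y t; rewrite /m /sg /ta /= /GRing.scale /=; ring.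
have mp : m p = N by rewrite /m /sg /ta; ring.
have m0 u : U u -> 0 <= m u.
  move=> Uu; rewrite /m; case: (ltgtP (ta u) 0) => tu.
  - have : k <= (N - a * sg u) / - ta u.
      by apply: ge_sup => // x [w [Uw tw] ->]; exact: sep.
    by rewrite ler_pdivlMr ?oppr_gt0 //; lra.
  - have : (a * sg u - N) / ta u <= k by apply: ub_le_sup => //; exists u.
    by rewrite ler_pdivrMr //; lra.
  - rewrite tu mulr0 addr0 subr_ge0.
    have [s0|s0] := ltP (sg u) 0; first by nra.
    have uE : u = p + (sg u / N) *: v by apply: on_line.
    have : U (p + (sg u / N) *: v) by rewrite -uE.
    move/gU; rewrite divr_ge0 ?(ltW N0) // => /(_ isT).
    by rewrite mulrA ltr_pdivrMr // mul1r; lra.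
exists m; split=> //; first by apply: (affine_gt0 oU cU Up am _ m0); rewrite mp.
rewrite (end_ratio_gauge Up Uq pq a0 gU) mp.
have -> : m q = N * (1 - a) by rewrite /m /sg /ta /N /v /=; ring.
have a1 : a < 1.
  have /(gU _ ler01) : U (p + 1 *: (q - p)) by rewrite scale1r addrC subrK.
  by rewrite mulr1.
by field; apply/andP; split; apply: lt0r_neq0 => //; lra.
Qed.

Lemma tight_ub m l p q : U p -> U q -> p <> q -> tight m p q ->
  is_affine l -> (forall u, U u -> 0 < l u) -> l p * m q <= m p * l q.
Proof.
move=> Up Uq pq [am m0 mE] al l0.
have := end_ratio_ub Up Uq pq al l0.
by rewrite mE ler_pdivrMr ?l0 // mulrAC ler_pdivlMr ?m0.
Qed.

(** For an affine competitor [n], [m p * n q - n p * m q] is [t - s] times the same expression at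
    [X] and [Y], so domination at one ordered pair of a line propagates to every other. *)
Lemma tight_line m X Y (s t : R) : U X -> U Y -> X <> Y -> tight m X Y ->
  U (X + s *: (Y - X)) -> U (X + t *: (Y - X)) -> s < t ->
  tight m (X + s *: (Y - X)) (X + t *: (Y - X)).
Proof.
move=> UX UY XY tm Us Ut st; have [am m0 _] := tm; split=> //.
set p := X + _ in Us *; set q := X + _ in Ut *.
have pq : p <> q.
  move=> /pair_equal_spec[] /=; rewrite /GRing.scale /= => e1 e2; apply: XY.
  have ts : t - s != 0 by rewrite subr_eq0 gt_eqF.
  apply: injective_projections; apply/eqP; rewrite -subr_eq0 -(mulrI_eq0 _ (mulfI ts));
    apply/eqP; lra.
have [n [an n0 nE]] := tight_exists Us Ut pq.
apply/eqP; rewrite eq_le end_ratio_ub // andbT nE.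
rewrite ler_pdivrMr ?n0 // mulrAC ler_pdivlMr ?m0 //.
rewrite -subr_ge0 /p /q !am !an.
rewrite (_ : _ - _ = (t - s) * (m X * n Y - n X * m Y)); last ring.
by apply: mulr_ge0; rewrite subr_ge0; [exact: ltW|exact: tight_ub].
Qed.

Lemma tight_ray m X Y (s : R) : U X -> U Y -> X <> Y -> tight m X Y ->
  U (X + s *: (Y - X)) -> 0 < s -> tight m X (X + s *: (Y - X)).
Proof.
move=> UX UY XY tm Us s0.
have := @tight_line m X Y 0 s; rewrite scale0r addr0; exact.
Qed.

Lemma tight_ray_back m X Y (s : R) : U X -> U Y -> X <> Y -> tight m Y X ->
  U (X + s *: (Y - X)) -> 0 < s -> tight m (X + s *: (Y - X)) X.
Proof.
move=> UX UY XY tm Us s0.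
have e : Y + (1 - s) *: (X - Y) = X + s *: (Y - X) by pt_eq ltac:(ring).
have e1 : Y + 1 *: (X - Y) = X by pt_eq ltac:(ring).
have := @tight_line m Y X (1 - s) 1; rewrite e e1.
by apply=> //; [exact: nesym|lra].
Qed.

Lemma hilbert_distE p q : p <> q ->
  hilbert_dist U p q = ln (end_ratio U q p * end_ratio U p q).
Proof. by rewrite /hilbert_dist; case: eqP. Qed.

Lemma end_ratio_ge1 p q : U p -> U q -> p <> q -> 1 <= end_ratio U p q.
Proof.
move=> Up Uq pq; rewrite -[leLHS](divr1 1).
apply: (end_ratio_ub (l := fun=> 1)) => // u v t.
by rewrite subrr mulr0 addr0.
Qed.

Lemma lerp_neq X Y (s : R) : X <> Y -> s != 0 -> X <> X + s *: (Y - X).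
Proof.
move=> XY s0 /eqP; rewrite -subr_eq0 opprD addNKr oppr_eq0 scaler_eq0 (negPf s0).
by rewrite subr_eq0 => /eqP /esym.
Qed.

(** The ratios of [m] and of [n] telescope. The three points are not assumed to be aligned, and this
    is what the final contradiction exploits. *)
Lemma hilbert_dist_chord X Y Z m n : U X -> U Y -> U Z -> X <> Z ->
  X <> Y -> Y <> Z -> tight m X Y -> tight m Y Z -> tight m X Z ->
  tight n Y X -> tight n Z Y -> tight n Z X ->
  hilbert_dist U X Z = hilbert_dist U X Y + hilbert_dist U Y Z.
Proof.
move=> UX UY UZ XZ XY YZ [_ m0 e1] [_ _ e2] [_ _ e3] [_ n0 e4] [_ _ e5] [_ _ e6].
have [? ? ?] := And3 (m0 _ UX) (m0 _ UY) (m0 _ UZ).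
have [? ? ?] := And3 (n0 _ UX) (n0 _ UY) (n0 _ UZ).
rewrite !hilbert_distE // e1 e2 e3 e4 e5 e6 -lnM ?posrE ?mulr_gt0 ?invr_gt0 //.
by congr ln; field; rewrite !gt_eqF.
Qed.

Lemma hilbert_dist_segment X Z (s : R) : U X -> U Z -> X <> Z -> 0 < s < 1 ->
  hilbert_dist U X Z = hilbert_dist U X (X + s *: (Z - X)) +
    hilbert_dist U (X + s *: (Z - X)) Z.
Proof.
move=> UX UZ XZ /andP[s0 s1].
have UY : U (X + s *: (Z - X)) by apply: convex_lerp => //; lra.
set Y := X + _ in UY *.
have XY : X <> Y by apply: lerp_neq => //; rewrite gt_eqF.
have YE : Y = Z + (1 - s) *: (X - Z) by rewrite /Y; pt_eq ltac:(ring).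
have ZX : Z <> X by apply: nesym.
have YZ : Y <> Z.
  by rewrite YE; apply/nesym/lerp_neq => //; rewrite subr_eq0 gt_eqF.
have [m tm] := tight_exists UX UZ XZ; have [n tn] := tight_exists UZ UX ZX.
have Xb : X + 1 *: (Z - X) = Z by rewrite scale1r addrC subrK.
apply: (@hilbert_dist_chord X Y Z m n) => //.
- exact: tight_ray.
- by have := @tight_line m X Z s 1; rewrite Xb; apply.
- exact: tight_ray_back.
- by rewrite YE; apply: tight_ray => //; rewrite -?YE //; lra.
Qed.

Lemma hilbert_dist_surj X Z (r : R) : U X -> U Z -> X <> Z ->
  0 < r < hilbert_dist U X Z ->
  exists2 s, 0 < s < 1 & hilbert_dist U X (X + s *: (Z - X)) = r.
Proof.
move=> UX UZ XZ; have ZX : Z <> X by apply: nesym.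
have [m tm] := tight_exists UX UZ XZ; have [n tn] := tight_exists UZ UX ZX.
have [am m0 mE] := tm; have [an n0 nE] := tn.
have [mX mZ] := (m0 _ UX, m0 _ UZ); have [nX nZ] := (n0 _ UX, n0 _ UZ).
rewrite hilbert_distE // mE nE => /andP[r0 rlt].
pose al := m Z / m X; pose be := n Z / n X; pose e := expR r.
have al0 : 0 < al by apply: divr_gt0.
have be0 : 0 < be by apply: divr_gt0.
have mZE : m Z = al * m X by rewrite /al divfK // gt_eqF.
have nZE : n Z = be * n X by rewrite /be divfK // gt_eqF.
have e1 : 1 < e by rewrite expR_gt1.
have eab : e * al < be.
  rewrite -ltr_pdivlMr // -ltr_ln ?posrE ?expR_gt0 ?divr_gt0 // expRK.
  rewrite (_ : be / al = be * (m X / m Z)) //; last by rewrite /al invf_div.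
(* With [Y] at parameter [s], the equation for the distance reads [1 + s * (be - 1) = e * (1 + s *
   (al - 1))]; it is linear in [s] with root [(e - 1) / D], and [e * al < be] places this root below
   1. *)
pose D := (be - 1) - e * (al - 1).
have D0 : e - 1 < D by rewrite /D; lra.
exists ((e - 1) / D); first by rewrite divr_gt0 ?ltr_pdivrMr; lra.
set s := _ / D.
have s01 : 0 < s < 1 by rewrite /s divr_gt0 ?ltr_pdivrMr; lra.
case/andP: (s01) => s0 s1.
have UY : U (X + s *: (Z - X)) by apply: convex_lerp => //; lra.
have [_ _ E1] := tight_ray UX UZ XZ tm UY s0.
have [_ _ E2] := tight_ray_back UX UZ XZ tn UY s0.
rewrite hilbert_distE; last by apply: lerp_neq => //; rewrite gt_eqF.
rewrite E1 E2 am an mZE nZE -[RHS]expRK -/e; congr ln.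
have mY : 0 < 1 + s * (al - 1) by nra.
have -> : m X + s * (al * m X - m X) = m X * (1 + s * (al - 1)) by ring.
have -> : n X + s * (be * n X - n X) = n X * (1 + s * (be - 1)) by ring.
have eq1 : 1 + s * (be - 1) = e * (1 + s * (al - 1)).
  apply/eqP; rewrite -subr_eq0; apply/eqP.
  rewrite (_ : _ - _ = 1 - e + s * D); last by rewrite /D; ring.
  by rewrite /s; field; apply: lt0r_neq0; lra.
by rewrite eq1; field; rewrite !gt_eqF.
Qed.

(** Both end ratios are at least 1, so each of them alone is bounded by the exponential of the
    distance. *)
Lemma hilbert_dist_ratio p q (D : R) l : U p -> U q ->
  hilbert_dist U p q <= D -> is_affine l -> (forall u, U u -> 0 < l u) ->
  l p <= expR D * l q /\ l q <= expR D * l p.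
Proof.
move=> Up Uq; have [->|/eqP pq] := eqVneq p q.
  rewrite /hilbert_dist eqxx => D0 al l0.
  by split; rewrite ler_peMl ?(ltW (l0 _ Uq)) // -expR0 ler_expR.
have qp : q <> p by apply: nesym.
rewrite hilbert_distE // => dD al l0.
have E1 := end_ratio_ge1 Up Uq pq; have E2 := end_ratio_ge1 Uq Up qp.
have E0 : 0 < end_ratio U q p * end_ratio U p q by nra.
have : end_ratio U q p * end_ratio U p q <= expR D.
  by rewrite -[leLHS](@lnK R) ?posrE // ler_expR.
have := end_ratio_ub Up Uq pq al l0; have := end_ratio_ub Uq Up qp al l0.
rewrite !ler_pdivrMr ?l0 // => h1 h2 h3.
have lp := l0 _ Up; have lq := l0 _ Uq.
split; [apply: (le_trans h2)|apply: (le_trans h1)]; apply: ler_wpM2r.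
- exact: ltW.
- by nra.
- exact: ltW.
- by nra.
Qed.

(* Functionals comparable at [Z] and [Z'] vanish simultaneously at the ends of
   the two rays, so a functional tight along one ray is tight along the other. *)
Lemma tight_transfer m X Y X' Y' (D : R) : U X -> U Y -> U X' -> U Y' ->
  X <> Y -> X' <> Y' -> tight m X Y ->
  (forall N : R, exists s s' : R, [/\ 1 <= s, 1 <= s',
    U (X + s *: (Y - X)) /\ U (X' + s' *: (Y' - X')),
    hilbert_dist U (X + s *: (Y - X)) (X' + s' *: (Y' - X')) <= D
    & N < hilbert_dist U X' (X' + s' *: (Y' - X'))]) ->
  tight m X' Y'.
Proof.
move=> UX UY UX' UY' XY XY' tm H; have [am m0 mE] := tm.
have [m' tm'] := tight_exists UX' UY' XY'.
have YX' : Y' <> X' by apply: nesym.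
have [n' tn'] := tight_exists UY' UX' YX'.
have [am' m0' mE'] := tm'; have [an' n0' nE'] := tn'.
split=> //; apply/eqP; rewrite eq_le (end_ratio_ub _ _ _ am) // andbT leNgt.
apply/negP; rewrite mE' ltr_pdivrMr ?m0 // mulrAC ltr_pdivlMr ?m0' // => lt.
pose de := m' X' * m Y' - m X' * m' Y'.
have de0 : 0 < de by rewrite subr_gt0.
have [mX mX'] := (m0 _ UX, m0 _ UX'); have [mY mY'] := (m0 _ UY, m0 _ UY').
have [m'X m'X'] := (m0' _ UX, m0' _ UX'); have m'Y' := m0' _ UY'.
have [nX' nY'] := (n0' _ UX', n0' _ UY').
pose k := expR D; have k0 : 0 < k by exact: expR_gt0.
pose G := k * k * (m X / m' X).
have G0 : 0 < G by rewrite !mulr_gt0 // invr_gt0.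
pose be := n' Y' / n' X'.
have be0 : 0 < be by apply: divr_gt0.
(* The threshold is the bound that failure of tightness would impose on the Hilbert distance from
   [X'] to every such [Z']. *)
have [s [s' [s1 s1' [UZ UZ'] dZ far]]] := H (ln (be * (G * m' X' ^+ 2 / de))).
set Z := X + _ in UZ dZ far; set Z' := X' + _ in UZ' dZ far.
have s0 : 0 < s by lra.
have s0' : 0 < s' by lra.
have [_ h1] := hilbert_dist_ratio UZ UZ' dZ am m0.
have [h2 _] := hilbert_dist_ratio UZ UZ' dZ am' m0'.
have XZ : X <> Z by apply: lerp_neq => //; rewrite gt_eqF.
have XZ' : X' <> Z' by apply: lerp_neq => //; rewrite gt_eqF.
have h3 := tight_ub UX UZ XZ (tight_ray UX UY XY tm UZ s0) am' m0'.
have [mZ mZ'] := (m0 _ UZ, m0 _ UZ'); have [m'Z m'Z'] := (m0' _ UZ, m0' _ UZ').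
(* Go from [Z'] to [Z] at cost [k], compare [m] with [m'] at [Z] by tightness of [m] from [X], and
   return at cost [k]. *)
have h4 : m Z' <= G * m' Z'.
  rewrite /G (mulrA _ (m X)) mulrAC ler_pdivlMr //.
  apply: (@le_trans _ _ (k * (m Z * m' X))); first by rewrite mulrA ler_pM2r.
  rewrite -!mulrA ler_pM2l // mulrC (le_trans h3) //.
  by rewrite [leRHS]mulrCA ler_pM2l.
have [_ _ E1] := tight_ray UX' UY' XY' tm' UZ' s0'.
have [_ _ E2] := tight_ray_back UX' UY' XY' tn' UZ' s0'.
move: far; rewrite hilbert_distE // E1 E2; apply/negP; rewrite -leNgt.
rewrite ler_ln ?posrE ?mulr_gt0 ?invr_gt0 ?n0' ?exprn_gt0 //.
(* [n'] grows at most linearly in [s']. If [m] is not tight, [h4] makes [m'] grow at least linearly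
   too, so the factors [s'] cancel in the product of end ratios. *)
have h5 : n' Z' / n' X' <= s' * be.
  by rewrite ler_pdivrMr // /be -mulrA divfK ?gt_eqF // /Z' an'; nra.
have h6 : m' X' / m' Z' <= G * m' X' ^+ 2 / (s' * de).
  rewrite ler_pdivrMr // mulrAC ler_pdivlMr ?mulr_gt0 //.
  have : m Z' * m' X' - m X' * m' Z' = s' * de by rewrite /Z' am am' /de; ring.
  move=> <-; rewrite (_ : G * _ * _ = m' X' * (G * m' Z' * m' X')); last ring.
  rewrite ler_pM2l //.
  apply: (@le_trans _ _ (m Z' * m' X')); last by rewrite ler_pM2r.
  by rewrite gerBl mulr_ge0 ?ltW.
have p1 : 0 <= n' Z' / n' X' by rewrite divr_ge0 // ltW // n0'.
have p2 : 0 <= m' X' / m' Z' by rewrite divr_ge0 // ltW.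
apply: (le_trans (ler_pM p1 p2 h5 h6)).
rewrite le_eqVlt; apply/orP; left; apply/eqP.
by field; rewrite !gt_eqF.
Qed.

End HilbertMetric.

(** * Isometries onto a Hilbert geometry *)

Section Rigidity.
Variables (R : realType) (P U : set (R * R)) (d : R * R -> R * R -> R).
Variable f : R * R -> R * R.
Hypotheses (oU : open U) (cU : convex_set U) (bij_f : set_bij P U f).
Hypothesis isom : forall x y, P x -> P y -> hilbert_dist U (f x) (f y) = d x y.
Hypothesis d_segment : forall x y z, P x -> P y -> P z ->
  (d x z = d x y + d y z <-> segment x z y).
Implicit Types (x y z p v w : R * R) (m : R * R -> R).

Definition open_segment v w p := exists2 mu : R, 0 < mu < 1 & p = v + mu *: (w - v).

(* The metric traits of a side of a polygon: it is at infinite distance, while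
   points approaching it at the same rate stay at bounded distance. *)
Definition horizon_side v w := [/\
  forall x p (e : R), P x -> open_segment v w p -> 0 < e <= 1 ->
    P (p + e *: (x - p)),
  forall x x' p p', P x -> P x' -> open_segment v w p -> open_segment v w p' ->
    exists D : R, forall e : R, 0 < e <= 1 ->
      d (p + e *: (x - p)) (p' + e *: (x' - p')) <= D
  & forall x p (N : R), P x -> open_segment v w p ->
    exists2 e0 : R, 0 < e0 & forall e, 0 < e < e0 -> N < d x (p + e *: (x - p))].

Let fU x : P x -> U (f x). Proof. by case: bij_f => /(_ x) H _ _ /H. Qed.

Let f_inj x y : P x -> P y -> f x = f y -> x = y.
Proof. by case: bij_f => _ inj _ Px Py; apply: inj; rewrite inE. Qed.

Let d_self x : P x -> d x x = 0.
Proof.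
move=> Px; have [_] := d_segment Px Px Px.
have xx : segment x x x by exists 0; [lra|rewrite scale0r addr0].
by move=> /(_ xx) ?; lra.
Qed.

(** Nonnegativity comes from [U], separation from [P]: if [d x y] vanished, [x], [y], [x] would be
    an additive triple, and [y] would lie on a segment reduced to [x]. *)
Let d_gt0 x y : P x -> P y -> x <> y -> 0 < d x y.
Proof.
move=> Px Py xy; rewrite -isom //.
have fxy : f x <> f y by move/(f_inj Px Py).
rewrite hilbert_distE //.
have E1 := end_ratio_ge1 oU cU (fU Px) (fU Py) fxy.
have E2 := end_ratio_ge1 oU cU (fU Py) (fU Px) (nesym fxy).
rewrite lt_neqAle ln_ge0 ?andbT; last by rewrite mulr_ege1.
rewrite eq_sym; apply/eqP => ln0; apply: xy.
have dxy : d x y = 0 by rewrite -isom // hilbert_distE.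
have dyx : d y x = 0 by rewrite -isom // hilbert_distE 1?mulrC //; exact: nesym.
have [+ _] := d_segment Px Py Px; rewrite d_self // dxy dyx addr0.
by case=> // t _ ->; rewrite subrr scaler0 addr0.
Qed.

(** Geodesics of [U] may be non-unique, so the argument returns to [P]: the point of the image
    segment at distance [d x y] from [f x] has a preimage [y'] on the segment from [x] to [z], as
    far from [x] as [y] is, whence [y' = y]. *)
Lemma isometry_segment x z (t : R) : P x -> P z -> x <> z -> 0 < t < 1 ->
  P (x + t *: (z - x)) ->
  exists2 s : R, 0 < s < 1 & f (x + t *: (z - x)) = f x + s *: (f z - f x).
Proof.
move=> Px Pz xz t01 Py; set y := x + _ in Py *.
have [t0 t1] := andP t01.
have xy : x <> y by apply: lerp_neq => //; rewrite gt_eqF.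
have yz : y <> z.
  have -> : y = z + (1 - t) *: (x - z) by rewrite /y; pt_eq ltac:(ring).
  by apply/nesym/lerp_neq; [exact: nesym|rewrite subr_eq0 gt_eqF].
have dxz : d x z = d x y + d y z.
  by apply/(d_segment Px Py Pz); exists t => //; lra.
have fxz : f x <> f z by move/(f_inj Px Pz).
have r0 : 0 < d x y < hilbert_dist U (f x) (f z).
  by rewrite isom // dxz d_gt0 //= ltrDl d_gt0.
have [s s01 sE] := hilbert_dist_surj oU cU (fU Px) (fU Pz) fxz r0.
exists s => //; have [s0 s1] := andP s01.
have UW : U (f x + s *: (f z - f x)).
  by apply: convex_lerp => //; [exact: fU|exact: fU|lra].
have [_ _ /(_ _ UW)[y' Py' yE]] := bij_f.
have dxy' : d x y' = d x y by rewrite -isom // yE.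
have dxz' : d x z = d x y' + d y' z.
  by rewrite -!isom // yE; apply: hilbert_dist_segment => //; exact: fU.
have [t' t01' y'E] := (d_segment Px Py' Pz).1 dxz'.
rewrite -yE; congr f; apply: contrapT => yy'.
have [t'0 t'1] := andP t01'.
have [tt|tt|tt] := ltgtP t t'; last by apply: yy'; rewrite y'E -tt.
- have : d x y' = d x y + d y y'.
    apply/(d_segment Px Py Py'); exists (t / t').
      by rewrite divr_ge0 ?ler_pdivrMr; lra.
    have ? : t' != 0 by apply: lt0r_neq0; lra.
    by rewrite y'E; pt_eq ltac:(field).
  by have := d_gt0 Py Py' yy'; lra.
- have : d x y = d x y' + d y' y.
    apply/(d_segment Px Py' Py); exists (t' / t).
      by rewrite divr_ge0 ?ler_pdivrMr; lra.
    have ? : t != 0 by apply: lt0r_neq0; lra.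
    by rewrite y'E /y; pt_eq ltac:(field).
  by have := d_gt0 Py' Py (nesym yy'); lra.
Qed.

Lemma isometry_ray x y p (t e : R) : P x -> P y -> x <> y -> 0 < t ->
  y = x + t *: (p - x) -> 0 < e < 1 - t -> P (p + e *: (x - p)) ->
  exists2 s : R, 1 <= s & f (p + e *: (x - p)) = f x + s *: (f y - f x).
Proof.
move=> Px Py xy t0 yE /andP[e0 e1] Pz; set z := p + _ in Pz *.
have en : 1 - e != 0 by apply: lt0r_neq0; lra.
have yzE : y = x + (t / (1 - e)) *: (z - x).
  by rewrite yE /z; pt_eq ltac:(field).
have xz : x <> z by move=> xz; apply: xy; rewrite yzE -xz subrr scaler0 addr0.
have t01 : 0 < t / (1 - e) < 1 by rewrite divr_gt0 ?ltr_pdivrMr; lra.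
have := @isometry_segment x z _ Px Pz xz t01; rewrite -yzE => /(_ Py).
move=> [s /andP[s0 s1] ->]; exists s^-1; first by rewrite invf_ge1 // ltW.
have sn : s != 0 by rewrite gt_eqF.
by rewrite addrAC subrr add0r scalerA mulVf // scale1r addrC subrK.
Qed.

Lemma tight_horizon_side v w m x y x' y' p p' (t t' : R) : horizon_side v w ->
  P x -> P y -> P x' -> P y' -> x <> y -> x' <> y' ->
  open_segment v w p -> open_segment v w p' ->
  0 < t < 1 -> 0 < t' < 1 ->
  y = x + t *: (p - x) -> y' = x' + t' *: (p' - x') ->
  tight U m (f x) (f y) -> tight U m (f x') (f y').
Proof.
move=> [Pnear bnd far] Px Py Px' Py' xy xy' op op' /andP[t0 t1] /andP[t0' t1'].
move=> yE yE' tm.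
have [D DE] := bnd _ _ _ _ Px Px' op op'.
apply: (tight_transfer (D := D) oU cU _ _ _ _ _ _ tm).
- exact: fU.
- exact: fU.
- exact: fU.
- exact: fU.
- by move/(f_inj Px Py).
- by move/(f_inj Px' Py').
move=> N; have [e0 e00 e0E] := far _ _ N Px' op'.
(* Small enough that both approaching points have passed [y] and [y'] on their rays and that the
   second one is beyond the distance [N]. *)
pose e := Num.min e0 (Num.min (1 - t) (1 - t')) / 2.
have m0 : 0 < Num.min e0 (Num.min (1 - t) (1 - t')).
  by rewrite !lt_min e00 !subr_gt0 t1.
have m1 : Num.min e0 (Num.min (1 - t) (1 - t')) <= e0 by rewrite ge_min lexx.
have m2 : Num.min e0 (Num.min (1 - t) (1 - t')) <= 1 - t.
  by rewrite !ge_min lexx orbT.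
have m3 : Num.min e0 (Num.min (1 - t) (1 - t')) <= 1 - t'.
  by rewrite !ge_min lexx !orbT.
have e1 : 0 < e <= 1 by rewrite /e; apply/andP; split; lra.
have Pz := Pnear _ _ _ Px op e1; have Pz' := Pnear _ _ _ Px' op' e1.
have [|s s1 sE] := isometry_ray Px Py xy t0 yE _ Pz.
  by rewrite /e; apply/andP; split; lra.
have [|s' s1' sE'] := isometry_ray Px' Py' xy' t0' yE' _ Pz'.
  by rewrite /e; apply/andP; split; lra.
exists s, s'; rewrite -sE -sE'; split=> //.
- by split; apply: fU.
- by rewrite isom //; exact: DE.
- by rewrite isom //; apply: e0E; rewrite /e; apply/andP; split; lra.
Qed.

Definition ray_hits v w x y :=
  exists p (t : R), [/\ open_segment v w p, 0 < t < 1 & y = x + t *: (p - x)].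

Lemma isometry_segment_of_sides v w v' w' x y z :
  horizon_side v w -> horizon_side v' w' -> P x -> P y -> P z -> x <> z ->
  ray_hits v w x y -> ray_hits v w y z -> ray_hits v w x z ->
  ray_hits v' w' z y -> ray_hits v' w' y x -> ray_hits v' w' z x ->
  segment x z y.
Proof.
move=> hs hs' Px Py Pz xz r1 r2 r3 r1' r2' r3'.
have [xy|xy] := pselect (x = y).
  by exists 0; [lra|rewrite scale0r addr0].
have [yz|yz] := pselect (y = z).
  by exists 1; [lra|rewrite scale1r addrC subrK].
have [fxy fyz fxz] : [/\ f x <> f y, f y <> f z & f x <> f z].
  by split=> /f_inj e; [apply: xy|apply: yz|apply: xz]; apply: e.
have [zy yx zx] := And3 (nesym yz) (nesym xy) (nesym xz).
have [m tm] := tight_exists oU cU (fU Px) (fU Pz) fxz.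
have [n tn] := tight_exists oU cU (fU Pz) (fU Px) (nesym fxz).
move: r1 r2 r3 => [p1 [t1 [h1 T1 E1]]] [p2 [t2 [h2 T2 E2]]] [p3 [t3 [h3 T3 E3]]].
move: r1' r2' r3' => [q1 [s1 [u1 S1 F1]]] [q2 [s2 [u2 S2 F2]]] [q3 [s3 [u3 S3 F3]]].
apply/(d_segment Px Py Pz); rewrite -!isom //.
apply: (@hilbert_dist_chord _ U _ _ _ m n) => //; try exact: fU.
- exact: (tight_horizon_side hs Px Pz Px Py xz xy h3 h1 T3 T1).
- exact: (tight_horizon_side hs Px Pz Py Pz xz yz h3 h2 T3 T2).
- exact: (tight_horizon_side hs' Pz Px Py Px zx yx u3 u2 S3 S2).
- exact: (tight_horizon_side hs' Pz Px Pz Py zx zy u3 u1 S3 S1).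
Qed.

End Rigidity.

(** * Arcs of the circle seen from a boundary point *)

Section CircleView.
Variables (R : realType) (th : R * R).
Hypothesis th1 : unit_circle th.
Implicit Types (x y c u v : R * R) (P : set (R * R)).

Lemma unit_circleP x : unit_circle x <-> dot x x = 1.
Proof.
rewrite /unit_circle /Defs.edist /dot /= !subr0 -!expr2.
split=> [e|->]; last by rewrite sqrtr1.
by rewrite -[LHS]sqr_sqrtr ?addr_ge0 ?sqr_ge0 // e expr1n.
Qed.

Lemma unit_diskP x : unit_disk x <-> dot x x < 1.
Proof.
rewrite /unit_disk /Defs.edist /dot /= !subr0 -!expr2.
rewrite -{1}[1](@sqrtr1 R) ltr_sqrt //.
Qed.

Let thE : dot th th = 1. Proof. exact/unit_circleP. Qed.

(* The cotangent of the angle at [th], counted from the tangent line, under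
   which [x] is seen: half of the arc cut off by the chord through [x]. *)
Definition cotview x : R := crossp th x / (1 - dot x th).
(** By the tangent-chord theorem the arc is twice the angle at [th], and [pi / 2 - atan] inverts the
    cotangent on []0, pi[]. *)
Definition arcview x : R := pi - 2 * atan (cotview x).

Lemma dot_lt1 x : dot x x <= 1 -> x <> th -> 0 < 1 - dot x th.
Proof.
move=> x1 xth; have : 0 < dot (x - th) (x - th).
  by apply: dot_gt0 => /eqP; rewrite subr_eq0 => /eqP.
by move: thE x1; rewrite /dot /=; lra.
Qed.

Lemma disk_neq_theta x : unit_disk x -> x <> th.
Proof. by move=> /unit_diskP + e; rewrite e thE ltxx. Qed.

Lemma disk_dot_lt1 x : unit_disk x -> 0 < 1 - dot x th.
Proof.
by move=> dx; apply: dot_lt1; [apply/ltW/unit_diskP|exact: disk_neq_theta].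
Qed.

Lemma arcview_itv x : 0 < arcview x < 2 * pi.
Proof.
have := atan_ltpi2 (cotview x); have := atan_gtNpi2 (cotview x).
by rewrite /arcview; lra.
Qed.

Lemma ler_atan : {mono (@atan R) : a b / a <= b}.
Proof. by apply: le_mono; exact: lt_atan. Qed.

Lemma ler_arcview x y : (arcview x <= arcview y) = (cotview y <= cotview x).
Proof. by rewrite /arcview lerD2l lerN2 ler_pM2l // ler_atan. Qed.

Lemma cos_arcview x : let c := cotview x in
  cos (arcview x) = (c ^+ 2 - 1) / (1 + c ^+ 2).
Proof.
move=> c; rewrite /arcview -/c addrC mulr_natl cosDpi cosN cos_mulr2n cos_atan exprVn.
have h : 0 < 1 + c ^+ 2 by rewrite ltr_pwDl // sqr_ge0.
by rewrite sqr_sqrtr ?(ltW h) //; field; rewrite gt_eqF.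
Qed.

Lemma sin_arcview x : let c := cotview x in
  sin (arcview x) = c *+ 2 / (1 + c ^+ 2).
Proof.
move=> c; rewrite /arcview -/c addrC mulr_natl sinDpi sinN sin_mulr2n opprK.
have h : 0 < 1 + c ^+ 2 by rewrite ltr_pwDl // sqr_ge0.
have cp : cos (atan c) != 0 by rewrite cos_atan invr_neq0 // sqrtr_eq0 -ltNge.
have -> : sin (atan c) = c * cos (atan c).
  by have := congr1 ( *%R^~ (cos (atan c))) (atanK c); rewrite /tan divfK.
rewrite mulrCA -expr2 cos_atan exprVn sqr_sqrtr ?(ltW h) // -mulrnAl.
by rewrite mulrnAl.
Qed.

Lemma rotate_arcview x : let c := cotview x in
  rotate (arcview x) th = ((c ^+ 2 - 1) / (1 + c ^+ 2)) *: th +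
    (c *+ 2 / (1 + c ^+ 2)) *: (- th.2, th.1).
Proof.
by move=> c; rewrite /rotate cos_arcview sin_arcview -/c; pt_eq ltac:(ring).
Qed.

(** An expansion in the orthonormal frame of tangent and inner normal at [th]; [cotview] is the
    quotient of the two coordinates. *)
Lemma theta_decomp x : x - th = crossp th x *: (- th.2, th.1) - (1 - dot x th) *: th.
Proof.
move: thE; rewrite /dot /crossp => e.
apply: injective_projections; rewrite /= /GRing.scale /=.
  by rewrite -{1}[x.1]mulr1 -{1}e; ring.
by rewrite -{1}[x.2]mulr1 -{1}e; ring.
Qed.

(** The coefficient is the squared distance from [x] to [th] divided by [2 * (1 - dot x th)]: it is
    1 on the circle and less than 1 in the disk. *)
Lemma chord_arcview x : 0 < 1 - dot x th ->
  x = th + ((1 - dot x th) * (1 + cotview x ^+ 2) / 2) *: (rotate (arcview x) th - th).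
Proof.
move=> x0; rewrite rotate_arcview; set c := cotview x.
have h : 1 + c ^+ 2 != 0 by rewrite gt_eqF // ltr_pwDl // sqr_ge0.
have cE : crossp th x = c * (1 - dot x th) by rewrite /c divfK // gt_eqF.
rewrite -{1}(subrK th x) (theta_decomp x) cE.
by pt_eq ltac:(field).
Qed.

Lemma dot_sub_theta x : dot (x - th) (x - th) = crossp th x ^+ 2 + (1 - dot x th) ^+ 2.
Proof.
rewrite (theta_decomp x); move: thE; set a := crossp _ _; set b := 1 - _.
rewrite /dot /= /GRing.scale /= => e.
by rewrite -[RHS]mulr1 -e; ring.
Qed.

Lemma circle_rotate (t : R) : unit_circle (rotate t th).
Proof.
apply/unit_circleP; have := cos2Dsin2 t; move: thE.
rewrite /dot /rotate /= => e1 e2.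
by rewrite -[RHS]mulr1 -{1}e2 -{1}e1; ring.
Qed.

Lemma circle_arcview c : off_theta th c -> c = rotate (arcview c) th.
Proof.
move=> [/unit_circleP c1 cth].
have c0 : 0 < 1 - dot c th by apply: dot_lt1 => //; rewrite c1.
rewrite {1}(chord_arcview c0).
have -> : (1 - dot c th) * (1 + cotview c ^+ 2) / 2 = 1.
  have : crossp th c ^+ 2 + (1 - dot c th) ^+ 2 = 2 * (1 - dot c th).
    by rewrite -dot_sub_theta; move: c1 thE; rewrite /dot /=; lra.
  move=> e; have -> : (1 - dot c th) * (1 + cotview c ^+ 2) / 2 =
     (crossp th c ^+ 2 + (1 - dot c th) ^+ 2) / (2 * (1 - dot c th)).
    by rewrite /cotview; field; rewrite gt_eqF.
  by rewrite e divff // gt_eqF // mulr_gt0.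
by rewrite scale1r addrC subrK.
Qed.

Lemma rotate_inj (s t : R) : 0 <= s < 2 * pi -> 0 <= t < 2 * pi ->
  rotate s th = rotate t th -> s = t.
Proof.
wlog st : s t / s <= t.
  by move=> H s0 t0 e; have [/H|/ltW /H] := leP s t; [exact|move=> h; exact/esym/h].
move=> /andP[s0 s2] /andP[t0 t2] /pair_equal_spec[] /= e1 e2.
have ce : cos s = cos t /\ sin s = sin t.
  move: thE e1 e2; rewrite /dot => e e1 e2; split.
    rewrite -[LHS]mulr1 -[RHS]mulr1 -e.
    have -> : cos s * (th.1 * th.1 + th.2 * th.2) =
      (cos s * th.1 - sin s * th.2) * th.1 + (sin s * th.1 + cos s * th.2) * th.2 by ring.
    by rewrite e1 e2; ring.
  rewrite -[LHS]mulr1 -[RHS]mulr1 -e.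
  have -> : sin s * (th.1 * th.1 + th.2 * th.2) =
    (sin s * th.1 + cos s * th.2) * th.1 - (cos s * th.1 - sin s * th.2) * th.2 by ring.
  by rewrite e1 e2; ring.
have c1 : cos (t - s) = 1.
  by rewrite cosB ce.1 ce.2 -!expr2 cos2Dsin2.
apply/eqP; rewrite eq_le st /= leNgt; apply/negP => lt.
(* A cosine equal to 1 kills the sine of the half angle, which is impossible for a half angle in
   []0, pi[]. *)
have : 0 < sin ((t - s) / 2) by apply: sin_gt0_pi; lra.
have : cos (((t - s) / 2) *+ 2) = 1 by rewrite -mulr_natr divfK.
have := cos2Dsin2 ((t - s) / 2); rewrite cos_mulr2n mulr2n => h1 h2 h3.
have : 0 < sin ((t - s) / 2) ^+ 2 by rewrite exprn_gt0.
lra.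
Qed.

Lemma ccw_rotate (t : R) : 0 <= t < 2 * pi -> ccw_length th (rotate t th) = t.
Proof.
move=> t02; rewrite /ccw_length; apply: get_unique; first by split.
by move=> s [s02 e]; apply: rotate_inj.
Qed.

Lemma ccw_arcview c : off_theta th c -> ccw_length th c = arcview c.
Proof.
move=> oc; rewrite {1}(circle_arcview oc) ccw_rotate //.
by have := arcview_itv c; lra.
Qed.

Lemma ccw_theta : ccw_length th th = 0.
Proof.
have e : th = rotate 0 th by rewrite /rotate cos0 sin0; pt_eq ltac:(ring).
by rewrite {2}e ccw_rotate //; have := pi_gt0 R; lra.
Qed.

Lemma off_theta_rotate (t : R) : 0 < t < 2 * pi -> off_theta th (rotate t th).
Proof.
move=> t0; split; first exact: circle_rotate.
move=> e; have := ccw_theta; rewrite -{2}e ccw_rotate; lra.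
Qed.

Lemma cotview_lerp x c (s : R) : s != 0 -> x = th + s *: (c - th) ->
  cotview x = cotview c.
Proof.
move=> s0 ->; rewrite /cotview.
have -> : crossp th (th + s *: (c - th)) = s * crossp th c.
  by rewrite /crossp /= /GRing.scale /=; ring.
have -> : 1 - dot (th + s *: (c - th)) th = s * (1 - dot c th).
  by move: thE; rewrite /dot /= /GRing.scale /= => e; rewrite -e; ring.
by rewrite -mulf_div divff // mul1r.
Qed.

Lemma chord_cotview c x : x <> th -> chord th c x -> cotview x = cotview c.
Proof.
move=> xth [s _ xE]; apply: (cotview_lerp (s := s)) => //.
by apply/eqP => s0; apply: xth; rewrite xE s0 scale0r addr0.
Qed.

Lemma chord_rotate_arcview x : unit_disk x -> chord th (rotate (arcview x) th) x.
Proof.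
move=> dx; have x0 := disk_dot_lt1 dx.
exists ((1 - dot x th) * (1 + cotview x ^+ 2) / 2); last exact: chord_arcview.
have e : (1 - dot x th) * (1 + cotview x ^+ 2) =
     (crossp th x ^+ 2 + (1 - dot x th) ^+ 2) / (1 - dot x th).
  by rewrite /cotview; field; rewrite gt_eqF.
rewrite e; apply/andP; split.
  apply: divr_ge0 => //; apply: divr_ge0; last exact: ltW.
  by rewrite addr_ge0 ?sqr_ge0.
rewrite -dot_sub_theta ler_pdivrMr // ler_pdivrMr //.
by move/unit_diskP: dx; move: thE; rewrite /dot /=; lra.
Qed.

Lemma second_endpointE x : unit_disk x ->
  second_endpoint th x = rotate (arcview x) th.
Proof.
move=> dx; have [u oth] := off_theta_rotate (arcview_itv x).
apply: get_unique; first by split=> //; exact: chord_rotate_arcview.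
move=> y [cy yth chy]; rewrite (circle_arcview (conj cy yth)) /arcview.
by rewrite (chord_cotview (disk_neq_theta dx) chy).
Qed.

Lemma ccw_second_endpoint x : unit_disk x ->
  ccw_length th (second_endpoint th x) = arcview x.
Proof.
move=> dx; rewrite second_endpointE // ccw_rotate //.
by have := arcview_itv x; lra.
Qed.

Lemma region_arcview xi eta x : off_theta th xi -> off_theta th eta ->
  arcview xi <= arcview eta -> x <> th -> region th xi eta x ->
  arcview xi <= arcview x <= arcview eta.
Proof.
move=> oxi oeta le xth [c [cc +] chx].
rewrite (ccw_arcview oxi) (ccw_arcview oeta) min_l // max_r // => h.
have cth : c <> th.
  move=> ce; move: h; rewrite ce ccw_theta.
  by have := arcview_itv xi; lra.
rewrite (ccw_arcview (conj cc cth)) in h.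
by rewrite /arcview (chord_cotview xth chx).
Qed.

Lemma arcview_region xi eta x : off_theta th xi -> off_theta th eta ->
  unit_disk x -> arcview xi <= arcview x <= arcview eta -> region th xi eta x.
Proof.
move=> oxi oeta dx /andP[h1 h2]; exists (rotate (arcview x) th).
  split; first exact: circle_rotate.
  rewrite (ccw_arcview oxi) (ccw_arcview oeta) min_l ?max_r ?(le_trans h1 h2) //.
  rewrite ccw_rotate ?h1 ?h2 //.
  by have := arcview_itv x; lra.
exact: chord_rotate_arcview.
Qed.

End CircleView.

(** * The pseudometric of a boundary point *)

(** Trades angles, in which the arcs are measured, for cotangents, which are quotients of affine
    functions; on a bounded range this costs only a factor. *)
Lemma atan_lipschitz (R : realType) (a b G : R) : a <= b -> - G <= a -> b <= G ->
  (b - a) / (1 + G ^+ 2) <= atan b - atan a <= b - a.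
Proof.
move=> ab Ga bG.
have [c|c cab ->] := MVT_segment ab (fun c _ => is_derive1_atan c).
  by apply: continuous_subspaceT => x; exact: continuous_atan.
move: cab; rewrite in_itv /= => /andP[ac cb].
have c2 : c ^+ 2 <= G ^+ 2 by rewrite -subr_ge0 subr_sqr mulr_ge0 //; lra.
have h0 : 0 < 1 + c ^+ 2 by rewrite ltr_pwDl // sqr_ge0.
have h1 : 0 < 1 + G ^+ 2 by rewrite ltr_pwDl // sqr_ge0.
apply/andP; split.
  by rewrite mulrC ler_wpM2r ?subr_ge0 // lef_pV2 ?posrE // lerD2l.
by rewrite ler_piMl ?subr_ge0 // invf_le1 // lerDl sqr_ge0.
Qed.

Section PolygonView.
Variables (R : realType) (P : set (R * R)) (r : R).
Hypotheses (P0 : P !=set0) (oP : open P) (r1 : r < 1) (r0 : 0 <= r).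
Hypothesis Pr : forall x, P x -> dot x x <= r ^+ 2.
Variable th : R * R.
Hypothesis th1 : unit_circle th.
Implicit Types (x y z p u : R * R).

Let thE : dot th th = 1. Proof. exact/unit_circleP. Qed.

Let r2 : r ^+ 2 < 1. Proof. by rewrite expr_lt1. Qed.

Lemma inner_disk x : dot x x <= r ^+ 2 -> unit_disk x.
Proof. by move=> xr; apply/unit_diskP; exact: le_lt_trans xr r2. Qed.

Let PD x : P x -> unit_disk x. Proof. by move/Pr; exact: inner_disk. Qed.

Lemma inner_bounds x : dot x x <= r ^+ 2 ->
  1 - r <= 1 - dot x th <= 2 /\ `|crossp th x| <= 1.
Proof.
move=> xr; have [r_ge0 r_lt1] := (r0, r1).
have e : dot x th ^+ 2 + crossp th x ^+ 2 <= r ^+ 2.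
  rewrite (_ : _ + _ = dot x x * dot th th); first by rewrite thE mulr1.
  by rewrite /dot /crossp; ring.
have h1 : 0 <= dot x th ^+ 2 by exact: sqr_ge0.
have h2 : 0 <= crossp th x ^+ 2 by exact: sqr_ge0.
have h3 : `|dot x th| <= r.
  by rewrite -ler_sqr ?nnegrE // real_normK ?num_real //; lra.
split; first by move: h3; rewrite ler_norml => /andP[h3 h4]; apply/andP; split; lra.
rewrite -ler_sqr ?nnegrE // real_normK ?num_real // expr1n; have := r2; lra.
Qed.

(** Depends on [r] only and not on [th], which makes all later estimates uniform in the family of
    boundary points. *)
Let G : R := (1 - r)^-1.

Lemma cotview_bound x : dot x x <= r ^+ 2 -> - G <= cotview th x <= G.
Proof.
move=> xr; have [/andP[h1 h2] h3] := inner_bounds xr; have r_lt1 := r1.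
have h0 : 0 < 1 - dot x th by lra.
rewrite -ler_norml /cotview normrM normfV (gtr0_norm h0) /G -[leRHS]mul1r.
apply: ler_pM => //; first by rewrite invr_ge0 ltW.
by rewrite lef_pV2 // posrE; lra.
Qed.

(** [arcview] decreases with [cotview], so the supremum belongs to the chord ending at [xi] and the
    infimum to the one ending at [eta]. *)
Definition cot_sup := sup (cotview th @` P).
Definition cot_inf := inf (cotview th @` P).

Let S0 : (cotview th @` P) !=set0.
Proof. by case: P0 => x Px; exists (cotview th x), x. Qed.

Let ubS : has_ubound (cotview th @` P).
Proof. by exists G => _ [x Px <-]; have /andP[] := cotview_bound (Pr Px). Qed.

Let lbS : has_lbound (cotview th @` P).
Proof. by exists (- G) => _ [x Px <-]; have /andP[] := cotview_bound (Pr Px). Qed.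

Lemma cot_sup_le c : (forall x, P x -> cotview th x <= c) -> cot_sup <= c.
Proof. by move=> h; apply: ge_sup => // _ [x Px <-]; exact: h. Qed.

Lemma cot_inf_ge c : (forall x, P x -> c <= cotview th x) -> c <= cot_inf.
Proof. by move=> h; apply: lb_le_inf => // _ [x Px <-]; exact: h. Qed.

Lemma cotview_shift x (e : R) : P x ->
  cotview th (x + e *: (- th.2, th.1)) = cotview th x + e / (1 - dot x th).
Proof.
move=> Px; have [/andP[h1 h2] h3] := inner_bounds (Pr Px).
rewrite /cotview; have -> : dot (x + e *: (- th.2, th.1)) th = dot x th.
  by rewrite /dot /= /GRing.scale /=; ring.
have -> : crossp th (x + e *: (- th.2, th.1)) = crossp th x + e * dot th th.
  by rewrite /dot /crossp /= /GRing.scale /=; ring.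
by rewrite thE mulr1 mulrDl.
Qed.

Lemma cotview_itv x : P x -> cot_inf < cotview th x < cot_sup.
Proof.
move=> Px; have h0 := disk_dot_lt1 th1 (PD Px).
have [e e0 eP] := open_near_line ((- th.2, th.1) : R * R) oP Px.
have P1 : P (x + e *: (- th.2, th.1)) by apply: eP; rewrite gtr0_norm.
have P2 : P (x + (- e) *: (- th.2, th.1)).
  by apply: eP; rewrite normrN gtr0_norm.
have d0 : 0 < e / (1 - dot x th) by rewrite divr_gt0.
apply/andP; split.
  apply: (@le_lt_trans _ _ (cotview th x + - e / (1 - dot x th))).
    by rewrite -cotview_shift //; apply: ge_inf => //; exact: imageP.
  by rewrite mulNr; lra.
apply: (@lt_le_trans _ _ (cotview th x + e / (1 - dot x th))); first lra.
by rewrite -cotview_shift //; apply: ub_le_sup => //; exact: imageP.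
Qed.

Let tm : R := pi - 2 * atan cot_sup.
Let tM : R := pi - 2 * atan cot_inf.

Let tmM : [/\ 0 < tm < 2 * pi, 0 < tM < 2 * pi & tm < tM].
Proof.
have [x Px] := P0; have /andP[h1 h2] := cotview_itv Px.
have := lt_atan (lt_trans h1 h2); rewrite /tm /tM.
have := atan_ltpi2 cot_sup; have := atan_gtNpi2 cot_sup.
have := atan_ltpi2 cot_inf; have := atan_gtNpi2 cot_inf.
by move=> *; split; lra.
Qed.

Let arcview_itvP x : P x -> tm < arcview th x < tM.
Proof.
move=> Px; have /andP[/lt_atan h1 /lt_atan h2] := cotview_itv Px.
by rewrite /tm /tM /arcview; lra.
Qed.

Let xi0 := rotate tm th.
Let eta0 := rotate tM th.
Let oxi0 : off_theta th xi0.
Proof. by apply: off_theta_rotate => //; case: tmM. Qed.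
Let oeta0 : off_theta th eta0.
Proof. by apply: off_theta_rotate => //; case: tmM. Qed.
Let xi0E : arcview th xi0 = tm.
Proof. by rewrite -ccw_arcview // ccw_rotate //; case: tmM; lra. Qed.
Let eta0E : arcview th eta0 = tM.
Proof. by rewrite -ccw_arcview // ccw_rotate //; case: tmM; lra. Qed.

Let P_region0 : P `<=` region th xi0 eta0.
Proof.
move=> x Px; apply: arcview_region => //; first exact: PD.
by rewrite xi0E eta0E; have := arcview_itvP Px; lra.
Qed.

Let region_ends a b : off_theta th a -> off_theta th b ->
  arcview th a <= arcview th b -> P `<=` region th a b ->
  arcview th a <= tm /\ tM <= arcview th b.
Proof.
move=> oa ob ab Pab.
have bnd x : P x -> cotview th b <= cotview th x <= cotview th a.
  move=> Px; have := region_arcview th1 oa ob ab (disk_neq_theta th1 (PD Px)) (Pab _ Px).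
  by rewrite !ler_arcview andbC.
have h1 : cot_sup <= cotview th a by apply: cot_sup_le => x /bnd /andP[].
have h2 : cotview th b <= cot_inf by apply: cot_inf_ge => x /bnd /andP[].
by rewrite /tm /tM /arcview; split; rewrite lerD2l lerN2 ler_pM2l // ler_atan.
Qed.

Let region_sub a b : off_theta th a -> off_theta th b ->
  arcview th a <= tm -> tM <= arcview th b ->
  region th xi0 eta0 `<=` region th a b.
Proof.
move=> oa ob ha hb x [c [cc h] chx]; exists c => //; split=> //; move: h.
have [_ _ tt] := tmM.
rewrite (ccw_arcview th1 oxi0) (ccw_arcview th1 oeta0) xi0E eta0E.
rewrite (ccw_arcview th1 oa) (ccw_arcview th1 ob) (min_l (ltW tt)) (max_r (ltW tt)).
by rewrite min_l ?max_r; lra.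
Qed.

Let region_sym a b : region th a b = region th b a.
Proof. by rewrite /region /arc_avoiding minC maxC. Qed.

Let xi_etaP : [/\ off_theta th (xi P th), off_theta th (eta P th),
  minimal_region P th (xi P th) (eta P th) & clockwise th (eta P th) (xi P th)].
Proof.
rewrite /xi /eta /xi_eta.
apply: (@getPex _ [set p | [/\ off_theta th p.1, off_theta th p.2,
  minimal_region P th p.1 p.2 & clockwise th p.2 p.1]]).
exists (xi0, eta0); split=> //=; last first.
  by rewrite /clockwise !ccw_arcview // xi0E eta0E; case: tmM; lra.
split=> // a b oa ob Pab sub; apply/seteqP; split=> //.
have [ab|/ltW ab] := leP (arcview th a) (arcview th b).
  by have [? ?] := region_ends oa ob ab Pab; exact: region_sub.
rewrite region_sym in Pab *.
by have [? ?] := region_ends ob oa ab Pab; exact: region_sub.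
Qed.

(** [get] returns some admissible pair, so all of them must be shown to agree. The chosen region
    contains that of [xi0] and [eta0], minimality makes them equal, and the ends of the chosen arc,
    which belong to the region, cannot lie beyond [tm] and [tM]. *)
Let xi_etaE : ccw_length th (xi P th) = tm /\ ccw_length th (eta P th) = tM.
Proof.
have [oxi oeta [Preg mreg] /andP[_ lt]] := xi_etaP.
rewrite !(ccw_arcview th1) // in lt *.
have [h1 h2] := region_ends oxi oeta (ltW lt) Preg.
have sub := region_sub oxi oeta h1 h2.
have regE := mreg _ _ oxi0 oeta0 P_region0 sub.
have end_in c : c = xi P th \/ c = eta P th -> region th (xi P th) (eta P th) c.
  move=> ce; have oc : off_theta th c by case: ce => ->.
  exists c; last by exists 1; [lra|rewrite scale1r addrC subrK].
  split; first by case: oc.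
  rewrite !(ccw_arcview th1) // (min_l (ltW lt)) (max_r (ltW lt)).
  by case: ce => ->; rewrite lexx ?ltW.
have tt : arcview th xi0 <= arcview th eta0.
  by rewrite xi0E eta0E ltW //; case: tmM.
have := end_in _ (or_introl erefl); have := end_in _ (or_intror erefl).
rewrite -regE => /(region_arcview th1 oxi0 oeta0 tt oeta.2).
move=> he /(region_arcview th1 oxi0 oeta0 tt oxi.2).
by rewrite xi0E eta0E in he *; move=> hx; split; lra.
Qed.

(** On [P], the gaps are half the arcs from the second endpoint to [xi] and to [eta]; the factor 2
    cancels in the cross-ratio. *)
Definition gap_sup x := atan cot_sup - atan (cotview th x).
Definition gap_inf x := atan (cotview th x) - atan cot_inf.
(** A real coordinate that turns [d_theta] into the distance of the line. *)
Definition log_view x := ln (gap_inf x / gap_sup x).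

Lemma gaps_gt0 x : P x -> 0 < gap_sup x /\ 0 < gap_inf x.
Proof.
move=> Px; have /andP[/lt_atan h1 /lt_atan h2] := cotview_itv Px.
by rewrite !subr_gt0.
Qed.

Lemma log_viewB x y : P x -> P y -> log_view x - log_view y =
  ln (gap_inf x / gap_inf y * (gap_sup y / gap_sup x)).
Proof.
move=> Px Py; have [sx ix] := gaps_gt0 Px; have [sy iy] := gaps_gt0 Py.
rewrite -ln_div ?posrE ?divr_gt0 //; congr ln; field.
by rewrite !gt_eqF.
Qed.

(** The sum of the two gaps does not depend on the point, so their quotient increases with the angle
    [atan (cotview th x)]. *)
Lemma ler_log_view x y : P x -> P y ->
  (log_view x <= log_view y) = (cotview th x <= cotview th y).
Proof.
move=> Px Py; have [sx ix] := gaps_gt0 Px; have [sy iy] := gaps_gt0 Py.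
rewrite ler_ln ?posrE ?divr_gt0 // ler_pdivrMr // mulrAC ler_pdivlMr //.
rewrite -ler_atan -[RHS]subr_ge0 -[LHS]subr_ge0.
rewrite (_ : _ - _ = (atan (cotview th y) - atan (cotview th x)) *
  (gap_sup x + gap_inf x)); last by rewrite /gap_sup /gap_inf; ring.
by rewrite pmulr_lge0 // addr_gt0.
Qed.

Lemma d_thetaE x y : P x -> P y ->
  d_theta P th x y = `|log_view x - log_view y|.
Proof.
have [exi eeta] := xi_etaE.
have lr u v : P u -> P v -> log_ratio P th u v = log_view u - log_view v.
  move=> Pu Pv; rewrite /log_ratio /arc_length exi eeta.
  rewrite (ccw_second_endpoint th1 (PD Pu)) (ccw_second_endpoint th1 (PD Pv)).
  have [su iu] := gaps_gt0 Pu; have [sv iv] := gaps_gt0 Pv.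
  have e1 z : 0 < gap_inf z -> `|tM - arcview th z| = 2 * gap_inf z.
    by rewrite /gap_inf /tM /arcview => h; rewrite gtr0_norm; lra.
  have e2 z : 0 < gap_sup z -> `|tm - arcview th z| = 2 * gap_sup z.
    by rewrite /gap_sup /tm /arcview => h; rewrite ltr0_norm; lra.
  rewrite !e1 // !e2 // log_viewB //; congr ln; field.
  by rewrite !gt_eqF.
move=> Px Py; rewrite /d_theta (ccw_second_endpoint th1 (PD Px)).
rewrite (ccw_second_endpoint th1 (PD Py)) ler_arcview.
rewrite -ler_log_view //; case: leP => h; rewrite lr //.
  by rewrite ger0_norm // subr_ge0.
by rewrite distrC ger0_norm // subr_ge0 ltW.
Qed.

(** Numerator and denominator of [cotview] are affine, so its value at [y] is a mean of the values
    at the ends with nonnegative weights. *)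
Lemma cotview_between x y z (t : R) : unit_disk x -> unit_disk z ->
  0 <= t <= 1 -> y = x + t *: (z - x) -> cotview th x <= cotview th z ->
  cotview th x <= cotview th y <= cotview th z.
Proof.
move=> /(disk_dot_lt1 th1) x0 /(disk_dot_lt1 th1) z0 /andP[t0 t1] yE.
have d1 : 1 - dot y th = (1 - t) * (1 - dot x th) + t * (1 - dot z th).
  by rewrite yE /dot /= /GRing.scale /=; ring.
have d2 : crossp th y = (1 - t) * crossp th x + t * crossp th z.
  by rewrite yE /crossp /= /GRing.scale /=; ring.
have y0 : 0 < 1 - dot y th.
  rewrite d1; have [->|tn] := eqVneq t 0.
    by rewrite subr0 mul1r mul0r addr0.
  apply: ltr_wpDl; first by apply: mulr_ge0; [lra|exact: ltW].
  by rewrite mulr_gt0 // lt_neqAle eq_sym tn.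
have ex : crossp th x = cotview th x * (1 - dot x th) by rewrite /cotview divfK // gt_eqF.
have ez : crossp th z = cotview th z * (1 - dot z th) by rewrite /cotview divfK // gt_eqF.
move=> xz; rewrite {2 3}/cotview ler_pdivlMr // ler_pdivrMr // d1 d2 ex ez.
rewrite -subr_ge0 -[X in _ && X]subr_ge0; apply/andP; split.
  rewrite (_ : _ - _ = t * (1 - dot z th) * (cotview th z - cotview th x)); last ring.
  by rewrite !mulr_ge0 ?subr_ge0 // -subr_ge0 ltW.
rewrite (_ : _ - _ = (1 - t) * (1 - dot x th) * (cotview th z - cotview th x)); last ring.
by rewrite !mulr_ge0 ?subr_ge0 // -subr_ge0 ltW.
Qed.

(** [1 + G ^+ 2] is the loss from angles to cotangents; [2 / (1 - r)] bounds the quotient of two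
    denominators [1 - dot u th]. *)
Let K : R := 2 * (1 + G ^+ 2) / (1 - r).

Let G0 : 0 < G. Proof. by rewrite invr_gt0 subr_gt0. Qed.
Let K0 : 0 < K.
Proof.
apply: divr_gt0; last by rewrite subr_gt0.
by apply: mulr_gt0 => //; rewrite ltr_pwDl // sqr_ge0.
Qed.

Let supG : - G <= cot_sup <= G /\ - G <= cot_inf <= G.
Proof.
have [x Px] := P0; have /andP[h1 h2] := cotview_itv Px.
have h3 : cot_sup <= G.
  by apply: cot_sup_le => u /Pr /cotview_bound /andP[].
have h4 : - G <= cot_inf.
  by apply: cot_inf_ge => u /Pr /cotview_bound /andP[].
by split; lra.
Qed.

(** The function [cot_sup * (1 - dot u th) - crossp th u] is affine and nonnegative on [P], and its
    quotient by [1 - dot u th] is [cot_sup - cotview th u]; similarly for [cot_inf]. *)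
Lemma gap_comparable x y (k : R) : P x -> P y -> 0 <= k ->
  (forall l, is_affine l -> (forall u, P u -> 0 <= l u) -> l x <= k * l y) ->
  gap_sup x <= K * k * gap_sup y /\ gap_inf x <= K * k * gap_inf y.
Proof.
move=> Px Py k0 H; have r_lt1 := r1.
have [/andP[hx1 hx2] _] := inner_bounds (Pr Px).
have [/andP[hy1 hy2] _] := inner_bounds (Pr Py).
have /andP[ix sx] := cotview_itv Px; have /andP[iy sy] := cotview_itv Py.
have /andP[Gx1 Gx2] := cotview_bound (Pr Px).
have /andP[Gy1 Gy2] := cotview_bound (Pr Py).
have [/andP[Gs1 Gs2] /andP[Gi1 Gi2]] := supG.
have g1 : 0 < 1 + G ^+ 2 by rewrite ltr_pwDl // sqr_ge0.
have x0 : 0 < 1 - dot x th by lra.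
have y0 : 0 < 1 - dot y th by lra.
have key (l : R * R -> R) (a b : R) : a = l x / (1 - dot x th) ->
    b = l y / (1 - dot y th) -> is_affine l -> (forall u, P u -> 0 <= l u) ->
    a <= K * k * (b / (1 + G ^+ 2)).
  move=> -> -> al l0; have lx := l0 _ Px; have ly := l0 _ Py.
  apply: (@le_trans _ _ (l x / (1 - r))).
    by rewrite ler_wpM2l // lef_pV2 ?posrE //; lra.
  apply: (@le_trans _ _ (k * l y / (1 - r))).
    by rewrite ler_wpM2r ?H // invr_ge0; lra.
  rewrite (_ : K * k * _ = k * l y / (1 - r) * (2 / (1 - dot y th))); last first.
    by rewrite /K; field; rewrite !gt_eqF //; lra.
  rewrite ler_peMr //; last by rewrite ler_pdivlMr // mul1r.
  by apply: divr_ge0; [exact: mulr_ge0|lra].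
have cE u : P u -> crossp th u = cotview th u * (1 - dot u th).
  by move=> Pu; rewrite /cotview divfK // gt_eqF // (disk_dot_lt1 th1 (PD Pu)).
split.
  have /andP[_ u1] := atan_lipschitz (ltW sx) Gx1 Gs2.
  have /andP[u2 _] := atan_lipschitz (ltW sy) Gy1 Gs2.
  apply: (le_trans u1); apply: le_trans (ler_wpM2l _ u2); last by rewrite mulr_ge0 // ltW.
  apply: (key (fun u => cot_sup * (1 - dot u th) - crossp th u)).
  - by rewrite cE // -mulrBl mulfK // gt_eqF.
  - by rewrite cE // -mulrBl mulfK // gt_eqF.
  - by move=> u v t; rewrite /dot /crossp /= /GRing.scale /=; ring.
  - move=> u Pu; rewrite cE // -mulrBl mulr_ge0 //.
      by have := cotview_itv Pu; lra.
    exact: ltW (disk_dot_lt1 th1 (PD Pu)).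
have /andP[_ u1] := atan_lipschitz (ltW ix) Gi1 Gx2.
have /andP[u2 _] := atan_lipschitz (ltW iy) Gi1 Gy2.
apply: (le_trans u1); apply: le_trans (ler_wpM2l _ u2); last by rewrite mulr_ge0 // ltW.
apply: (key (fun u => crossp th u - cot_inf * (1 - dot u th))).
- by rewrite cE // -mulrBl mulfK // gt_eqF.
- by rewrite cE // -mulrBl mulfK // gt_eqF.
- by move=> u v t; rewrite /dot /crossp /= /GRing.scale /=; ring.
- move=> u Pu; rewrite cE // -mulrBl mulr_ge0 //.
    by have := cotview_itv Pu; lra.
  exact: ltW (disk_dot_lt1 th1 (PD Pu)).
Qed.

(** The square appears because the cross-ratio is a product of two quotients of gaps, each bounded
    separately. *)
Lemma d_theta_bound x y (k : R) : P x -> P y -> 0 < k ->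
  (forall l, is_affine l -> (forall u, P u -> 0 <= l u) ->
    l x <= k * l y /\ l y <= k * l x) ->
  d_theta P th x y <= ln ((2 * (1 + ((1 - r)^-1) ^+ 2) / (1 - r) * k) ^+ 2).
Proof.
move=> Px Py k0 H; rewrite d_thetaE // -/G -/K.
have [sx ix] := gaps_gt0 Px; have [sy iy] := gaps_gt0 Py.
have [|s1 i1] := gap_comparable Px Py (ltW k0).
  by move=> l al l0; case: (H l al l0).
have [|s2 i2] := gap_comparable Py Px (ltW k0).
  by move=> l al l0; case: (H l al l0).
have Kk : 0 < K * k by rewrite mulr_gt0.
have le_ln u v : P u -> P v -> gap_sup v <= K * k * gap_sup u ->
    gap_inf u <= K * k * gap_inf v -> log_view u - log_view v <= ln ((K * k) ^+ 2).
  move=> Pu Pv s i; have [su iu] := gaps_gt0 Pu; have [sv iv] := gaps_gt0 Pv.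
  have q1 : 0 < gap_inf u / gap_inf v by exact: divr_gt0.
  have q2 : 0 < gap_sup v / gap_sup u by exact: divr_gt0.
  rewrite log_viewB // ler_ln ?posrE; [|exact: mulr_gt0|exact: exprn_gt0].
  by rewrite expr2; apply: ler_pM; rewrite ?ler_pdivrMr // ltW.
by rewrite ler_norml lerNl opprB !le_ln.
Qed.

(** Seen from [th], the point [p] is extreme. As the moving point tends to [p], the gap on that side
    is at most [e * C] while the opposite gap does not shrink, so the distance exceeds the logarithm
    of a constant over [e]. *)
Lemma d_theta_far x p (N : R) : P x -> dot p p <= r ^+ 2 ->
  (forall e, 0 < e <= 1 -> P (p + e *: (x - p))) ->
  (forall u, P u -> cotview th u < cotview th p) \/
  (forall u, P u -> cotview th p < cotview th u) ->
  exists2 e0, 0 < e0 & forall e, 0 < e < e0 -> e <= 1 ->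
    N < d_theta P th x (p + e *: (x - p)).
Proof.
move=> Px pr Pe side; have r_lt1 := r1.
have [/andP[hp1 hp2] _] := inner_bounds pr.
have [/andP[hx1 hx2] _] := inner_bounds (Pr Px).
have x0 : 0 < 1 - dot x th by lra.
have p0 : 0 < 1 - dot p th by lra.
have r10 : 0 < 1 - r by lra.
have cE u : unit_disk u -> crossp th u = cotview th u * (1 - dot u th).
  by move=> du; rewrite /cotview divfK // gt_eqF // (disk_dot_lt1 th1 du).
have [sx ix] := gaps_gt0 Px.
pose C := `|cotview th p - cotview th x| * (1 - dot x th) / (1 - r).
have C0 : 0 < C.
  rewrite divr_gt0 ?mulr_gt0 // normr_gt0 subr_eq0.
  by case: side => /(_ _ Px) h; rewrite ?(gt_eqF h) ?(lt_eqF h).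
pose E := expR N.
have E0 : 0 < E by exact: expR_gt0.
have diff e : 0 < e <= 1 ->
    `|cotview th p - cotview th (p + e *: (x - p))| <= e * C.
  move=> e01; have Pz := Pe _ e01; set z := p + _ in Pz *.
  have [/andP[hz1 hz2] _] := inner_bounds (Pr Pz).
  have z0 : 0 < 1 - dot z th by lra.
  have -> : cotview th p - cotview th z =
      e * ((cotview th p - cotview th x) * (1 - dot x th)) / (1 - dot z th).
    apply: (mulIf (x := 1 - dot z th)); first by rewrite gt_eqF.
    rewrite divfK ?gt_eqF // mulrBl -cE; last exact: PD.
    have -> : crossp th z = (1 - e) * crossp th p + e * crossp th x.
      by rewrite /z /crossp /= /GRing.scale /=; ring.
    have -> : 1 - dot z th = (1 - e) * (1 - dot p th) + e * (1 - dot x th).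
      by rewrite /z /dot /= /GRing.scale /=; ring.
    by rewrite (cE p) ?(cE x) //; [ring|exact: PD|exact: inner_disk].
  rewrite normrM normfV (gtr0_norm z0) !normrM (gtr0_norm x0).
  case/andP: e01 => e0 e1; rewrite (gtr0_norm e0) /C -mulrA ler_pM2l //.
  by rewrite ler_wpM2l ?mulr_ge0 ?(ltW x0) // lef_pV2 // posrE.
have big g : 0 < g -> exists2 e0, 0 < e0 & forall e, 0 < e < e0 -> E < g / (e * C).
  have EC : 0 < E * C by exact: mulr_gt0.
  move=> g0; exists (g / (E * C)); first exact: divr_gt0.
  move=> e /andP[e0]; rewrite ltr_pdivlMr // => h.
  by rewrite ltr_pdivlMr; [lra|exact: mulr_gt0].
have dp : unit_disk p by exact: inner_disk.
case: side => side.
  have [e0 e00 He] := big _ sx; exists e0 => // e ee e1.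
  have e01 : 0 < e <= 1 by case/andP: ee => -> _.
  have Pz := Pe _ e01; have := diff _ e01; have {}He := He _ ee.
  set z := p + _ in Pz *; have [sz iz] := gaps_gt0 Pz.
  have zp := side _ Pz; rewrite gtr0_norm ?subr_gt0 // => dz.
  have xz : cotview th x <= cotview th z.
    have zE : z = x + (1 - e) *: (p - x) by rewrite /z; pt_eq ltac:(ring).
    have e01' : 0 <= 1 - e <= 1 by lra.
    by have /andP[] := cotview_between (PD Px) dp e01' zE (ltW (side _ Px)).
  have h1 : gap_inf x <= gap_inf z by rewrite /gap_inf lerD2r ler_atan.
  have h2 : gap_sup z <= e * C.
    have cs : cot_sup <= cotview th p by apply: cot_sup_le => u /side /ltW.
    have /andP[Gz1 _] := cotview_bound (Pr Pz).
    have /andP[_ Gp2] := cotview_bound pr.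
    have /andP[_ u1] := atan_lipschitz (ltW zp) Gz1 Gp2.
    by rewrite -ler_atan in cs; rewrite /gap_sup; lra.
  rewrite d_thetaE // distrC (lt_le_trans _ (ler_norm _)) //.
  rewrite log_viewB // -[N](expRK N) -/E ltr_ln ?posrE ?mulr_gt0 ?invr_gt0 //.
  apply: (lt_le_trans He); rewrite -[leLHS]mul1r.
  have eC : 0 < e * C by case/andP: ee => e_0 _; rewrite mulr_gt0.
  apply: ler_pM => //; first by rewrite divr_ge0 // ltW.
    by rewrite ler_pdivlMr // mul1r.
  by rewrite ler_wpM2l ?(ltW sx) // lef_pV2.
have [e0 e00 He] := big _ ix; exists e0 => // e ee e1.
have e01 : 0 < e <= 1 by case/andP: ee => -> _.
have Pz := Pe _ e01; have := diff _ e01; have {}He := He _ ee.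
set z := p + _ in Pz *; have [sz iz] := gaps_gt0 Pz.
have zp := side _ Pz; rewrite ltr0_norm ?subr_lt0 // opprB => dz.
have xz : cotview th z <= cotview th x.
  have e01' : 0 <= e <= 1 by lra.
  by have /andP[] := cotview_between dp (PD Px) e01' erefl (ltW (side _ Px)).
have h1 : gap_sup x <= gap_sup z by rewrite /gap_sup lerD2l lerN2 ler_atan.
have h2 : gap_inf z <= e * C.
  have cs : cotview th p <= cot_inf by apply: cot_inf_ge => u /side /ltW.
  have /andP[_ Gz2] := cotview_bound (Pr Pz).
  have /andP[Gp1 _] := cotview_bound pr.
  have /andP[_ u1] := atan_lipschitz (ltW zp) Gp1 Gz2.
  by rewrite -ler_atan in cs; rewrite /gap_inf; lra.
rewrite d_thetaE // (lt_le_trans _ (ler_norm _)) //.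
rewrite log_viewB // -[N](expRK N) -/E ltr_ln ?posrE ?mulr_gt0 ?invr_gt0 //.
apply: (lt_le_trans He); rewrite -[leLHS]mulr1.
have eC : 0 < e * C by case/andP: ee => e_0 _; rewrite mulr_gt0.
apply: ler_pM => //; first by rewrite divr_ge0 // ltW.
  by rewrite ler_wpM2l ?(ltW ix) // lef_pV2.
by rewrite ler_pdivlMr // mul1r.
Qed.

End PolygonView.

(** * Lines, segments and rays *)

Section PlaneGeometry.
Variable R : realType.
Implicit Types (x y z p q u v w n g o : R * R).

Lemma dot_lerp_le u v (t c : R) : 0 <= t <= 1 -> dot u u <= c -> dot v v <= c ->
  dot (u + t *: (v - u)) (u + t *: (v - u)) <= c.
Proof.
move=> /andP[t0 t1] uc vc.
have -> : dot (u + t *: (v - u)) (u + t *: (v - u)) =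
    (1 - t) * dot u u + t * dot v v - t * (1 - t) * dot (v - u) (v - u).
  by rewrite /dot /= /GRing.scale /=; ring.
have h1 : 0 <= t * (1 - t) * dot (v - u) (v - u).
  by rewrite !mulr_ge0 ?subr_ge0 // addr_ge0 // -expr2 sqr_ge0.
have h2 : (1 - t) * dot u u <= (1 - t) * c by rewrite ler_wpM2l ?subr_ge0.
have h3 : t * dot v v <= t * c by rewrite ler_wpM2l.
lra.
Qed.

Lemma line_circle v n : unit_disk v -> n <> 0 -> exists t1 t2 : R,
  [/\ t1 < t2, unit_circle (v + t1 *: n), unit_circle (v + t2 *: n)
    & forall s, unit_disk (v + s *: n) -> t1 < s < t2].
Proof.
move=> /unit_diskP v1 /dot_gt0 N0.
pose D := dot v n ^+ 2 - dot n n * (dot v v - 1).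
have D0 : 0 < D.
  rewrite /D ltr_pwDr ?sqr_ge0 //.
  by rewrite oppr_gt0 pmulr_rlt0 // subr_lt0.
pose rt := Num.sqrt D.
have rt0 : 0 < rt by rewrite sqrtr_gt0.
have rtE : rt ^+ 2 = D by rewrite sqr_sqrtr // ltW.
have Nn : dot n n != 0 by rewrite gt_eqF.
have expand s : dot (v + s *: n) (v + s *: n) - 1 =
    ((dot n n * s + dot v n) ^+ 2 - D) / dot n n.
  rewrite /D; apply: (mulIf Nn); rewrite divfK //.
  by rewrite /dot /= /GRing.scale /=; ring.
exists ((- dot v n - rt) / dot n n), ((- dot v n + rt) / dot n n); split.
- by rewrite ltr_pM2r ?invr_gt0 // ltrD2l gtrN.
- apply/unit_circleP/eqP; rewrite -subr_eq0 expand (mulrC (dot n n)) divfK //.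
  by rewrite addrAC addNr add0r sqrrN rtE subrr mul0r.
- apply/unit_circleP/eqP; rewrite -subr_eq0 expand (mulrC (dot n n)) divfK //.
  by rewrite addrAC addNr add0r rtE subrr mul0r.
move=> s /unit_diskP; rewrite -subr_lt0 expand pmulr_llt0 ?invr_gt0 //.
rewrite subr_lt0 -rtE => h.
have : `|dot n n * s + dot v n| < rt.
  by rewrite -ltr_sqr ?nnegrE ?(ltW rt0) // real_normK ?num_real.
rewrite ltr_norml ltr_pdivrMr // ltr_pdivlMr // => /andP[h1 h2].
by apply/andP; split; lra.
Qed.

Lemma normal_dotl (k : R) u v :
  dot (k *: (v.2 - u.2, u.1 - v.1)) u = k * crossp u v.
Proof. by rewrite /dot /crossp /= /GRing.scale /=; ring. Qed.

Lemma normal_dotr (k : R) u v :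
  dot (k *: (v.2 - u.2, u.1 - v.1)) v = k * crossp u v.
Proof. by rewrite /dot /crossp /= /GRing.scale /=; ring. Qed.

Lemma dotZl (k : R) u v : dot (k *: u) v = k * dot u v.
Proof. by rewrite /dot /= /GRing.scale /=; ring. Qed.

Lemma dotZZ (k l : R) u v : dot (k *: u) (l *: v) = k * l * dot u v.
Proof. by rewrite /dot /= /GRing.scale /=; ring. Qed.

(** If [x - y] and [z - y] are independent, solve for value 1 at both; if one is a positive multiple
    of the other, rescale it; in the remaining cases [y] is on the segment. *)
Lemma separate_segment x y z : ~ segment x z y ->
  exists g, 1 <= dot g (x - y) /\ 1 <= dot g (z - y).
Proof.
move=> ns; set a := x - y; set b := z - y.
have [det0|detn] := eqVneq (crossp a b) 0; last first.
  exists ((crossp a b)^-1 *: (b.2 - a.2, a.1 - b.1)).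
  by rewrite normal_dotl normal_dotr mulVf.
have [a0|/eqP an] := eqVneq a 0.
  exfalso; apply: ns; exists 0; first lra.
  by rewrite scale0r addr0; apply/esym/eqP; rewrite -subr_eq0 -/a a0.
have N0 := dot_gt0 an.
have bE : b = 0 + (dot b a / dot a a) *: a.
  have := @on_line R b 0 a an; rewrite /= !subr0 => h.
  rewrite /dot -!expr2; apply: h.
  by rewrite -[RHS]det0 [RHS]/crossp /a /b /=; ring.
rewrite add0r in bE; set c := dot b a / dot a a in bE.
have [c0|c0] := ltP 0 c.
  exists ((dot a a)^-1 * (1 + c^-1) *: a).
  have e1 : dot ((dot a a)^-1 * (1 + c^-1) *: a) a = 1 + c^-1.
    by rewrite dotZl; field; rewrite !gt_eqF.
  have e2 : dot ((dot a a)^-1 * (1 + c^-1) *: a) b = 1 + c.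
    by rewrite bE dotZZ; field; rewrite !gt_eqF.
  by rewrite e1 e2 !lerDl invr_ge0 ltW.
exfalso; apply: ns; exists (1 / (1 - c)).
  by rewrite divr_ge0 ?ler_pdivrMr; lra.
have cn : 1 - c != 0 by apply: lt0r_neq0; lra.
have -> : z = y + c *: (x - y) by rewrite -bE addrC subrK.
by pt_eq ltac:(field).
Qed.

(** Strict inequalities on barycentric coordinates are stable under composition and small
    perturbation, unlike explicit hitting points. *)
Lemma ray_hits_bary v w x y (be ga : R) : 0 < be -> 0 < ga -> be + ga < 1 ->
  y = x + be *: (v - x) + ga *: (w - x) -> ray_hits v w x y.
Proof.
move=> be0 ga0 bg ->; have bgn : be + ga != 0 by apply: lt0r_neq0; lra.
exists (v + (ga / (be + ga)) *: (w - v)), (be + ga); split; last by pt_eq ltac:(field).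
  by eexists; [|reflexivity]; rewrite divr_gt0 ?ltr_pdivrMr; lra.
by lra.
Qed.

Lemma ray_hits_trans v w x y z :
  ray_hits v w x y -> ray_hits v w y z -> ray_hits v w x z.
Proof.
move=> [p [t [[m /andP[m0 m1] ->] /andP[t0 t1] ->]]].
move=> [q [s [[k /andP[k0 k1] ->] /andP[s0 s1] ->]]].
have st : 0 < (1 - s) * t by rewrite mulr_gt0 // subr_gt0.
apply: (@ray_hits_bary _ _ _ _ ((1 - s) * t * (1 - m) + s * (1 - k))
                       ((1 - s) * t * m + s * k)).
- by rewrite addr_gt0 ?mulr_gt0 ?subr_gt0.
- by rewrite addr_gt0 ?mulr_gt0 ?subr_gt0.
- rewrite [ltLHS](_ : _ = 1 - (1 - s) * (1 - t)); last ring.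
  by rewrite ltrBlDr ltrDl mulr_gt0 ?subr_gt0.
by pt_eq ltac:(ring).
Qed.

(** The point [o] lies between [x] and [z] on a line hitting the side at [p]. Since [o] is off the
    line of the side, [v - o] and [w - o] form a basis in which to expand the displacement [n]. *)
Lemma ray_hits_perturb v w x o z p n (t : R) : crossp (w - v) (o - v) != 0 ->
  open_segment v w p -> 0 < t < 1 -> o = x + t *: (p - x) ->
  z = o + 2^-1 *: (p - o) ->
  exists2 e0 : R, 0 < e0 & forall e, 0 < e < e0 ->
    ray_hits v w x (o + e *: n) /\ ray_hits v w (o + e *: n) z.
Proof.
move=> det [mu /andP[mu0 mu1] pE] /andP[t0 t1] oE zE.
pose K := crossp (w - v) (o - v).
(* Cramer's rule. *)
pose a := crossp n (w - o) / K; pose b := crossp (v - o) n / K.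
have nE : n = a *: (v - o) + b *: (w - o).
  rewrite /a /b; apply: injective_projections; rewrite /= /GRing.scale /=;
  apply: (mulfI det); rewrite -/K; move: det; rewrite -/K => det.
    rewrite (_ : K * (_ + _) = (crossp n (w - o) * (v.1 - o.1) +
       crossp (v - o) n * (w.1 - o.1))); last by field.
    by rewrite /K /crossp /=; ring.
  rewrite (_ : K * (_ + _) = (crossp n (w - o) * (v.2 - o.2) +
       crossp (v - o) n * (w.2 - o.2))); last by field.
  by rewrite /K /crossp /=; ring.
pose M := `|a| + `|b|; have M0 : 0 <= M by rewrite addr_ge0.
(* At most each of [t * mu], [t * (1 - mu)], [mu] and [1 - mu], the weights that must stay
   positive. *)
pose c := t * mu * (1 - mu).
have c0 : 0 < c by rewrite !mulr_gt0 ?subr_gt0.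
have tmu : t * mu < 1 by rewrite mulr_ilt1 // ltW.
have tmu' : t * (1 - mu) < 1 by rewrite mulr_ilt1 ?subr_ge0 ?ltW //; lra.
have tm0 : 0 < t * mu by rewrite mulr_gt0.
have tm0' : 0 < t * (1 - mu) by rewrite mulr_gt0 ?subr_gt0.
have cl1 : c <= t * mu by rewrite /c ler_piMr ?(ltW tm0) //; lra.
have cl2 : c <= t * (1 - mu).
  by rewrite /c mulrAC ler_piMr ?(ltW tm0') // ltW.
have tl1 : t * mu <= mu by apply: ler_piMl; exact: ltW.
have tl2 : t * (1 - mu) <= 1 - mu.
  by apply: ler_piMl; [rewrite subr_ge0|]; exact: ltW.
exists (c / (4 * (M + 1))); first by rewrite divr_gt0 // mulr_gt0 //; lra.
move=> e /andP[e0]; rewrite ltr_pdivlMr; last by lra.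
move=> ec.
have eM : e * M < c / 4 by lra.
have ea : `|e * a| <= e * M.
  by rewrite normrM (gtr0_norm e0) ler_wpM2l ?(ltW e0) // lerDl.
have eb : `|e * b| <= e * M.
  by rewrite normrM (gtr0_norm e0) ler_wpM2l ?(ltW e0) // lerDr.
move: ea eb; rewrite !ler_norml => /andP[ea1 ea2] /andP[eb1 eb2].
(* The weight of [o] when the displaced point is written as a barycentre of [o], [v] and [w]. *)
pose la := 1 - e * a - e * b.
have la0 : 2^-1 < la by rewrite /la; lra.
have lan : la != 0 by apply: lt0r_neq0; lra.
split.
  apply: (@ray_hits_bary _ _ _ _ (la * (t * (1 - mu)) + e * a) (la * (t * mu) + e * b)).
  - have : 2^-1 * (t * (1 - mu)) <= la * (t * (1 - mu)).
      by apply: ler_wpM2r; exact: ltW.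
    by lra.
  - have : 2^-1 * (t * mu) <= la * (t * mu).
      by apply: ler_wpM2r; exact: ltW.
    by lra.
  - rewrite [ltLHS](_ : _ = 1 - la * (1 - t)); last by rewrite /la; ring.
    by rewrite ltrBlDr ltrDl mulr_gt0 ?subr_gt0 //; lra.
  have oxE : o - x = (t * (1 - mu)) *: (v - x) + (t * mu) *: (w - x).
    by rewrite oE pE; pt_eq ltac:(ring).
  have -> : o + e *: n = x + la *: (o - x) + (e * a) *: (v - x) + (e * b) *: (w - x).
    by rewrite {1}nE /la; pt_eq ltac:(ring).
  by rewrite oxE; pt_eq ltac:(ring).
have li : la^-1 < 2 by rewrite invf_plt ?posrE //; lra.
have li0 : 0 < la^-1 by rewrite invr_gt0; lra.
have q1 : `|e * a / la| <= 2 * (c / 4).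
  rewrite normrM normfV (gtr0_norm (x := la)); last lra.
  rewrite mulrC; apply: ler_pM; [exact: ltW|exact: normr_ge0|exact: ltW|].
  by rewrite ler_norml; apply/andP; split; lra.
have q2 : `|e * b / la| <= 2 * (c / 4).
  rewrite normrM normfV (gtr0_norm (x := la)); last lra.
  rewrite mulrC; apply: ler_pM; [exact: ltW|exact: normr_ge0|exact: ltW|].
  by rewrite ler_norml; apply/andP; split; lra.
move: q1 q2; rewrite !ler_norml => /andP[q11 q12] /andP[q21 q22].
apply: (@ray_hits_bary _ _ _ _ (2^-1 * (1 - mu) - 2^-1 * (e * a / la))
                       (2^-1 * mu - 2^-1 * (e * b / la))).
- by lra.
- by lra.
- rewrite [ltLHS](_ : _ = 1 - 2^-1 / la); last by rewrite /la; field.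
  by rewrite ltrBlDr ltrDl divr_gt0 //; lra.
have zy y : o = la^-1 *: (y - (e * a) *: v - (e * b) *: w) ->
    z = y + (2^-1 * (1 - mu) - 2^-1 * (e * a / la)) *: (v - y) +
            (2^-1 * mu - 2^-1 * (e * b / la)) *: (w - y).
  move=> oy; rewrite zE pE oy; move: lan; rewrite /la => ?.
  by pt_eq ltac:(field).
apply: zy; rewrite nE; move: lan; rewrite /la => ?.
by pt_eq ltac:(field).
Qed.

End PlaneGeometry.

(** * Sides of a convex polygon *)

Lemma series_term_le (R : realType) (u : nat -> R) i : (forall n, 0 <= u n) ->
  cvgn (series u) -> u i <= limn (series u).
Proof.
move=> u0 cu; apply: (@le_trans _ _ (series u i.+1)).
  by rewrite /series /= big_nat_recr //= lerDr sumr_ge0.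
apply: nondecreasing_cvgn_le => //; apply/nondecreasing_seqP => n.
by rewrite /series /= big_nat_recr //= lerDl.
Qed.

Section PolygonSides.
Variables (R : realType) (P : set (R * R)) (sides : seq ((R * R) * (R * R))).
Hypothesis hP : convex_polygon P sides.
Implicit Types (x y z p u v w o : R * R).

Let oP : open P. Proof. by case: hP => -[]. Qed.
Let cP : convex_set P. Proof. by case: hP => -[]. Qed.
Let P0 : P !=set0. Proof. by case: hP => -[]. Qed.
Let PD : P `<=` @unit_disk R. Proof. by case: hP => -[]. Qed.
Let bdP : boundary P = [set x | exists2 s, s \in sides & segment s.1 s.2 x].
Proof. by case: hP => _ []. Qed.
Let sidesD s : s \in sides -> [/\ unit_disk s.1, unit_disk s.2 & s.1 <> s.2].
Proof. by case: hP => _ [+ _]; apply. Qed.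

Lemma boundary_hit o n : P o -> n <> 0 ->
  exists2 t : R, 0 < t & boundary P (o + t *: n).
Proof.
move=> Po n0; have [a a0 gP] := ray_gauge n oP cP Po.
move: a0; rewrite le_eqVlt => /predU1P[a0|a0]; last first.
  by exists a^-1; [rewrite invr_gt0|exact: gauge_boundary].
have [t1 [t2 [_ _ _ tD]]] := line_circle (PD Po) n0.
have PT : P (o + `|t2| *: n) by apply/gP; rewrite // -a0 mul0r.
by have /tD := PD PT; have := ler_norm t2; lra.
Qed.

(** Finitely many ends of sides lie in the open disk, hence in a smaller closed one, which contains
    the sides by convexity; a point of [P] lies between two boundary points. *)
Lemma polygon_radius : exists r : R, [/\ 0 <= r, r < 1 &
  forall x, closure P x -> dot x x <= r ^+ 2].
Proof.
have [c [c0 c1 sc]] : exists c : R, [/\ 0 <= c, c < 1 &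
    forall s, s \in sides -> dot s.1 s.1 <= c /\ dot s.2 s.2 <= c].
  move: sidesD; elim: sides => [|s l IH] sD.
    by exists 0; split=> //; exact: ltr01.
  have [|c [c0 c1 lc]] := IH.
    by move=> s' s'l; apply: sD; rewrite in_cons s'l orbT.
  have [/unit_diskP s1 /unit_diskP s2 _] := sD s (mem_head _ _).
  exists (Num.max c (Num.max (dot s.1 s.1) (dot s.2 s.2))); split.
  - by rewrite le_max c0.
  - by rewrite !gt_max c1 s1 s2.
  - move=> s'; rewrite in_cons => /predU1P[->|/lc[h1 h2]].
      by rewrite !le_max !lexx !orbT.
    by rewrite !le_max h1 h2.
have bc b : boundary P b -> dot b b <= c.
  rewrite bdP => -[s /sc[h1 h2]] [t t01 ->]; exact: dot_lerp_le.
exists (Num.sqrt c); split; first exact: sqrtr_ge0.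
  by rewrite -[ltRHS]sqrtr1 ltr_sqrt.
rewrite sqr_sqrtr // => x clx.
have [Px|nPx] := pselect (P x); last first.
  by apply: bc; split=> // /interior_subset.
have n0 : ((1, 0) : R * R) <> 0 by case=> /eqP; rewrite oner_eq0.
have n0' : (- (1, 0) : R * R) <> 0 by move/eqP; rewrite oppr_eq0 => /eqP.
have [t t0 /bc bt] := boundary_hit Px n0.
have [t' t0' /bc bt'] := boundary_hit Px n0'.
have tt : t + t' != 0 by apply: lt0r_neq0; lra.
have t01 : 0 <= t / (t + t') <= 1 by rewrite divr_ge0 ?ler_pdivrMr; lra.
have := dot_lerp_le t01 bt bt'; congr (dot _ _ <= _); pt_eq ltac:(field; exact: tt).
Qed.

Lemma side_boundary s x : s \in sides -> segment s.1 s.2 x ->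
  closure P x /\ ~ P x.
Proof.
move=> ss sx; have : boundary P x by rewrite bdP; exists s.
move=> [clx nx]; split=> // Px; apply: nx.
by have /interior_id -> := oP.
Qed.

Lemma segment_ends v w : segment v w v /\ segment v w w.
Proof.
split; first by exists 0; [lra|rewrite scale0r addr0].
by exists 1; [lra|rewrite scale1r addrC subrK].
Qed.

(** A point of [P] on the line of the side but off the side would have one end of the side strictly
    between itself and the other end, putting that end in [P]. *)
Lemma side_line s u : s \in sides -> P u -> crossp (s.2 - s.1) (u - s.1) != 0.
Proof.
move=> ss Pu; have [_ _ vw] := sidesD ss.
have [sv sw] := segment_ends s.1 s.2.
have [clv nv] := side_boundary ss sv; have [clw nw] := side_boundary ss sw.
apply/eqP => c0.
have wv0 : s.2 - s.1 <> 0 by move/eqP; rewrite subr_eq0 => /eqP /esym.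
have c0' : (u.2 - s.1.2) * (s.2 - s.1).1 - (u.1 - s.1.1) * (s.2 - s.1).2 = 0.
  by rewrite -[RHS]c0 /crossp /=; ring.
have := on_line wv0 c0'; set k := (X in X *: _) => uE.
have [k0|k0] := ltP k 0.
  have kn : 1 - k != 0 by apply: lt0r_neq0; lra.
  apply: nv; have : 0 <= - k / (1 - k) < 1 by rewrite divr_ge0 ?ltr_pdivrMr; lra.
  move/(interior_closure oP cP Pu clw); congr (P _).
  by rewrite uE; pt_eq ltac:(field).
have [k1|k1] := ltP 1 k.
  have kn : k != 0 by apply: lt0r_neq0; lra.
  apply: nw; have : 0 <= (k - 1) / k < 1 by rewrite divr_ge0 ?ltr_pdivrMr; lra.
  move/(interior_closure oP cP Pu clv); congr (P _).
  by rewrite uE; pt_eq ltac:(field).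
have [|_ nu] := @side_boundary s u ss; last exact: nu.
by exists k => //; rewrite k0 k1.
Qed.

Lemma side_sign s : s \in sides ->
  (forall u, P u -> 0 < crossp (s.2 - s.1) (u - s.1)) \/
  (forall u, P u -> crossp (s.2 - s.1) (u - s.1) < 0).
Proof.
move=> ss; pose f u := crossp (s.2 - s.1) (u - s.1).
have mix u u' : P u -> P u' -> 0 < f u -> f u' < 0 -> False.
  move=> Pu Pu' fu fu'.
  pose t := f u / (f u - f u').
  have d0 : f u - f u' != 0 by apply: lt0r_neq0; lra.
  have t01 : 0 <= t <= 1 by rewrite /t divr_ge0 ?ler_pdivrMr; lra.
  have /(side_line ss)/eqP := convex_lerp cP Pu Pu' t01; apply.
  rewrite (_ : crossp _ _ = f u + t * (f u' - f u)).
    by rewrite /t; field.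
  by rewrite /f /crossp /= /GRing.scale /=; ring.
have [ o Po] := P0.
case: (ltgtP 0 (f o)) => [pos_o|neg_o|zero_o].
- left=> u Pu; have /eqP := side_line ss Pu; rewrite -/(f u).
  by case: (ltgtP (f u) 0) => // fu _; case: (mix o u).
- right=> u Pu; have /eqP := side_line ss Pu; rewrite -/(f u).
  by case: (ltgtP (f u) 0) => // fu _; case: (mix u o).
- by have /eqP := side_line ss Po; rewrite -/(f o) -zero_o.
Qed.

(** A direction steeper than those from [o] to the finitely many ends of sides misses them all. The
    case of an end equal to [o] disappears for [o] in [P]. *)
Lemma steep_slope o : exists k : R, forall s, s \in sides -> forall t : R,
  (s.1 = o + t *: (1, k) -> s.1 = o) /\ (s.2 = o + t *: (1, k) -> s.2 = o).
Proof.
have [k kE] : exists k : R, forall s, s \in sides ->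
    (s.1.2 - o.2) / (s.1.1 - o.1) < k /\ (s.2.2 - o.2) / (s.2.1 - o.1) < k.
  elim: sides => [|s l [k lk]]; first by exists 0.
  exists (Num.max k (Num.max ((s.1.2 - o.2) / (s.1.1 - o.1))
                             ((s.2.2 - o.2) / (s.2.1 - o.1))) + 1).
  move=> s'; rewrite in_cons => /predU1P[->|/lk[h1 h2]].
    by split; rewrite ltr_pwDr // !le_max lexx !orbT.
  by split; rewrite ltr_pwDr // le_max ltW.
have slope x t : x = o + t *: (1, k) -> (x.2 - o.2) / (x.1 - o.1) < k -> x = o.
  move=> xE; have [t0|tn] := eqVneq t 0; first by rewrite xE t0 scale0r addr0.
  have -> : x.2 - o.2 = t * k by rewrite xE /= /GRing.scale /=; ring.
  have -> : x.1 - o.1 = t by rewrite xE /= /GRing.scale /=; ring.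
  by rewrite mulrAC divff // mul1r ltxx.
exists k => s /kE[h1 h2] t; split=> /slope; exact.
Qed.

Lemma side_hit o n : P o -> n <> 0 ->
  (forall s, s \in sides -> forall t : R,
    (s.1 = o + t *: n -> s.1 = o) /\ (s.2 = o + t *: n -> s.2 = o)) ->
  exists s (t : R), [/\ s \in sides, 0 < t & open_segment s.1 s.2 (o + t *: n)].
Proof.
move=> Po n0 avoid; have [t t0] := boundary_hit Po n0.
rewrite bdP => -[s ss [mu mu01 bE]]; exists s, t; split=> //.
have [sv sw] := segment_ends s.1 s.2.
have [_ nv] := side_boundary ss sv; have [_ nw] := side_boundary ss sw.
have [av aw] := avoid s ss t.
exists mu => //; case/andP: mu01 => mu0 mu1; apply/andP; split.
  rewrite lt_neqAle mu0 andbT; apply/eqP => mu00; apply: nv; rewrite av //.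
  by rewrite bE -mu00 scale0r addr0.
rewrite lt_neqAle mu1 andbT; apply/eqP => mu11; apply: nw; rewrite aw //.
by rewrite bE mu11 scale1r addrC subrK.
Qed.

(** A line through [o] avoiding the vertices leaves [P] through the relative interiors of two sides,
    at [p] and [q]. Take [x] and [z] halfway from [o] to these points, and for [y] a slight
    orthogonal displacement of [o]. *)
Lemma polygon_triangle : exists x y z s1 s2,
  [/\ P x, P y, P z, x <> z & ~ segment x z y] /\
  [/\ s1 \in sides, s2 \in sides,
      ray_hits s1.1 s1.2 x y /\ ray_hits s1.1 s1.2 y z
    & ray_hits s2.1 s2.2 z y /\ ray_hits s2.1 s2.2 y x].
Proof.
have [ o Po] := P0; have [k kE] := steep_slope o.
pose n : R * R := (1, k).
have n0 : n <> 0 by case=> /eqP; rewrite oner_eq0.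
have n0' : - n <> 0 by move/eqP; rewrite oppr_eq0 => /eqP.
have [s1 [t1 [ss1 t10 o1]]] := side_hit Po n0 kE.
have [|s2 [t2 [ss2 t20 o2]]] := side_hit Po n0'.
  by move=> s ss t; have := kE s ss (- t); rewrite scalerN scaleNr.
pose p := o + t1 *: n; pose q := o + t2 *: - n.
pose x := o + 2^-1 *: (q - o); pose z := o + 2^-1 *: (p - o).
have clp : closure P p.
  by case: o1 => mu mu01 e; apply: (side_boundary ss1 _).1; exists mu; [lra|].
have clq : closure P q.
  by case: o2 => mu mu01 e; apply: (side_boundary ss2 _).1; exists mu; [lra|].
have h01 : 0 <= (2^-1 : R) < 1 by lra.
have Px : P x by exact: interior_closure oP cP Po clq h01.
have Pz : P z by exact: interior_closure oP cP Po clp h01.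
pose m : R * R := (- k, 1).
have [e1 e10 He1] : exists2 e0 : R, 0 < e0 & forall e, 0 < e < e0 ->
    ray_hits s1.1 s1.2 x (o + e *: m) /\ ray_hits s1.1 s1.2 (o + e *: m) z.
  have d : 2 * t1 + t2 != 0 by apply: lt0r_neq0; lra.
  (* On this line [x] is at [- t2 / 2], [o] at 0 and [p] at [t1], which gives the position of [o]
     between [x] and [p]. *)
  apply: (@ray_hits_perturb _ _ _ x o z p m (t2 / (2 * t1 + t2))) => //.
  - exact: side_line.
  - by rewrite divr_gt0 ?ltr_pdivrMr; lra.
  - by rewrite /x /p /q /n; pt_eq ltac:(field; exact: d).
have [e2 e20 He2] : exists2 e0 : R, 0 < e0 & forall e, 0 < e < e0 ->
    ray_hits s2.1 s2.2 z (o + e *: m) /\ ray_hits s2.1 s2.2 (o + e *: m) x.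
  have d : 2 * t2 + t1 != 0 by apply: lt0r_neq0; lra.
  apply: (@ray_hits_perturb _ _ _ z o x q m (t1 / (2 * t2 + t1))) => //.
  - exact: side_line.
  - by rewrite divr_gt0 ?ltr_pdivrMr; lra.
  - by rewrite /z /p /q /n; pt_eq ltac:(field; exact: d).
have [e3 e30 He3] := open_near_line m oP Po.
pose e := Num.min e1 (Num.min e2 e3) / 2.
have m0 : 0 < Num.min e1 (Num.min e2 e3) by rewrite !lt_min e10 e20.
have m1 : Num.min e1 (Num.min e2 e3) <= e1 by rewrite ge_min lexx.
have m2 : Num.min e1 (Num.min e2 e3) <= e2 by rewrite !ge_min lexx orbT.
have m3 : Num.min e1 (Num.min e2 e3) <= e3 by rewrite !ge_min lexx !orbT.
have e0 : 0 < e by rewrite /e; lra.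
exists x, (o + e *: m), z, s1, s2; split; last first.
  split=> //; first by apply: He1; rewrite /e; apply/andP; split; lra.
  by apply: He2; rewrite /e; apply/andP; split; lra.
split=> //.
- by apply: He3; rewrite gtr0_norm // /e; lra.
- move=> /pair_equal_spec[] + _; rewrite /x /z /p /q /n /= /GRing.scale /=.
  by lra.
- move=> [t _] /pair_equal_spec[]; rewrite /x /z /p /q /n /m /= /GRing.scale /=.
  move=> h1 h2.
  have k2 : 0 <= k ^+ 2 by exact: sqr_ge0.
  suff : e * (1 + k ^+ 2) = 0.
    by apply/eqP; rewrite mulf_neq0 // gt_eqF //; lra.
  have h1' : e * - k = 2^-1 * - t2 + t * (2^-1 * t1 + 2^-1 * t2) by lra.
  have h2' : e = k * (2^-1 * - t2 + t * (2^-1 * t1 + 2^-1 * t2)) by lra.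
  rewrite -h1' in h2'.
  by rewrite mulrDr mulr1 {1}h2'; ring.
Qed.

End PolygonSides.

(** * The weighted metric of a polygon *)

(** Which side of the line through [th] and [p] contains [u] becomes a comparison of cotangents. *)
Lemma crossp_cotview (R : realType) (th p u : R * R) : unit_circle th ->
  unit_disk p -> unit_disk u ->
  crossp (p - th) (u - th) =
    (1 - dot p th) * (1 - dot u th) * (cotview th p - cotview th u).
Proof.
move=> th1 dp du; rewrite !(theta_decomp th1).
have cE x : unit_disk x -> crossp th x = cotview th x * (1 - dot x th).
  by move=> dx; rewrite /cotview divfK // gt_eqF // (disk_dot_lt1 th1 dx).
rewrite (cE _ dp) (cE _ du) -[RHS]mulr1 -((unit_circleP th).1 th1).
set a := 1 - dot p th; set b := 1 - dot u th.
set c := cotview th p; set c' := cotview th u.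
by rewrite /crossp /dot /= /GRing.scale /=; ring.
Qed.

(** The sign of [g] on [u - th] becomes the sign of an affine function of the single number
    [cotview th u]. *)
Lemma dot_cotview (R : realType) (th g u : R * R) : unit_circle th ->
  unit_disk u ->
  dot g (u - th) = (1 - dot u th) *
    (cotview th u * dot g (- th.2, th.1) - dot g th).
Proof.
move=> th1 du; rewrite (theta_decomp th1).
have -> : crossp th u = cotview th u * (1 - dot u th).
  by rewrite /cotview divfK // gt_eqF // (disk_dot_lt1 th1 du).
set a := 1 - dot u th; set c := cotview th u.
by rewrite /dot /= /GRing.scale /=; ring.
Qed.

Lemma dist_between (R : realType) (a b c : R) : `|a - c| = `|a - b| + `|b - c| ->
  a <= b <= c \/ c <= b <= a.
Proof.
have [ab|ab] := leP a b; have [bc|bc] := leP b c; last by right; rewrite !ltW.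
- by left.
- rewrite (ler0_norm (x := a - b)) ?subr_le0 // (gtr0_norm (x := b - c)) ?subr_gt0 //.
  have [ac|ac] := leP a c.
    by rewrite ler0_norm ?subr_le0 // => ?; left; apply/andP; split; lra.
  by rewrite gtr0_norm ?subr_gt0 // => ?; right; apply/andP; split; lra.
- rewrite (gtr0_norm (x := a - b)) ?subr_gt0 // (ler0_norm (x := b - c)) ?subr_le0 //.
  have [ac|ac] := leP a c.
    by rewrite ler0_norm ?subr_le0 // => ?; left; apply/andP; split; lra.
  by rewrite gtr0_norm ?subr_gt0 // => ?; right; apply/andP; split; lra.
Qed.

Section PolygonDistance.
Variables (R : realType) (P : set (R * R)) (sides : seq ((R * R) * (R * R))).
Variables (theta : nat -> R * R) (w : nat -> R).
Hypothesis hP : convex_polygon P sides.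
Hypothesis theta_circle : forall i, unit_circle (theta i).
Hypothesis theta_dense : @unit_circle R `<=` closure (range theta).
Hypothesis theta_sides : side_chords_in (range theta) sides.
Hypothesis w_gt0 : forall i, 0 < w i.
Hypothesis w_sum : cvgn (series w).
Implicit Types (x y z p u : R * R).

Let oP : open P. Proof. by case: hP => -[]. Qed.
Let cP : convex_set P. Proof. by case: hP => -[]. Qed.
Let P0 : P !=set0. Proof. by case: hP => -[]. Qed.
Let PD : P `<=` @unit_disk R. Proof. by case: hP => -[]. Qed.

Let term x y i := w i * d_theta P (theta i) x y.
Let d := polygon_dist P theta w.

Lemma polygon_inner_radius : exists r : R, [/\ 0 <= r, r < 1 &
  forall x, P x -> dot x x <= r ^+ 2].
Proof.
have [r [r0 r1 Pr]] := polygon_radius hP.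
by exists r; split=> // x Px; apply: Pr; exact: subset_closure.
Qed.

Lemma d_theta_log_view i x y : P x -> P y ->
  d_theta P (theta i) x y = `|log_view P (theta i) x - log_view P (theta i) y|.
Proof.
have [r [r0 r1 Pr]] := polygon_inner_radius.
exact: (d_thetaE P0 oP r1 r0 Pr).
Qed.

Lemma log_view_mono i x y : P x -> P y ->
  (log_view P (theta i) x <= log_view P (theta i) y) =
  (cotview (theta i) x <= cotview (theta i) y).
Proof.
have [r [r0 r1 Pr]] := polygon_inner_radius.
exact: (ler_log_view oP r1 r0 Pr).
Qed.

Let term_ge0 x y i : P x -> P y -> 0 <= term x y i.
Proof. by move=> Px Py; rewrite mulr_ge0 ?(ltW (w_gt0 i)) // d_theta_log_view. Qed.

(** [K] is chosen before [i]: it depends only on the radius of a disk around [P]. This serves both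
    convergence and boundedness of the sum. *)
Lemma d_theta_le_comparable : exists2 K : R, 0 < K & forall x y (k : R) i,
  P x -> P y -> 0 < k ->
  (forall l, is_affine l -> (forall u, P u -> 0 <= l u) ->
    l x <= k * l y /\ l y <= k * l x) ->
  d_theta P (theta i) x y <= ln ((K * k) ^+ 2).
Proof.
have [r [r0 r1 Pr]] := polygon_inner_radius.
exists (2 * (1 + ((1 - r)^-1) ^+ 2) / (1 - r)).
  apply: divr_gt0; last by rewrite subr_gt0.
  by apply: mulr_gt0 => //; rewrite ltr_pwDl // sqr_ge0.
by move=> x y k i; exact: (d_theta_bound P0 oP r1 r0 Pr).
Qed.

Let cvg_scaled (M : R) : cvgn (series (fun i => w i * M)).
Proof.
have -> : (fun i => w i * M) = M *: w by apply/funext => i; rewrite mulrC.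
exact: is_cvg_seriesZ.
Qed.

Let cvg_term x y : P x -> P y -> cvgn (series (term x y)).
Proof.
move=> Px Py; have [K K0 HK] := d_theta_le_comparable.
have [k1 k11 h1] := affine_comparable y oP Px.
have [k2 k21 h2] := affine_comparable x oP Py.
have k0 : 0 < k1 + k2 by lra.
have H l : is_affine l -> (forall u, P u -> 0 <= l u) ->
    l x <= (k1 + k2) * l y /\ l y <= (k1 + k2) * l x.
  move=> al l0; have := h1 l al l0; have := h2 l al l0.
  have [lx ly] := (l0 _ Px, l0 _ Py).
  have : 0 <= k1 * l y by rewrite mulr_ge0 //; lra.
  have : 0 <= k2 * l x by rewrite mulr_ge0 //; lra.
  by move=> *; split; lra.
have bnd i := HK x y _ i Px Py k0 H.
apply: (@series_le_cvg R _ (fun i => w i * ln ((K * (k1 + k2)) ^+ 2))).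
- by move=> i; exact: term_ge0.
- move=> i; apply: le_trans (term_ge0 i Px Py) _.
  by rewrite ler_wpM2l ?bnd // ltW.
- by move=> i; rewrite ler_wpM2l ?bnd // ltW.
- exact: cvg_scaled.
Qed.

Let term_le x y i : P x -> P y -> term x y i <= d x y.
Proof.
move=> Px Py; apply: series_term_le; last exact: cvg_term.
by move=> n; exact: term_ge0.
Qed.

Let log_view_between i x y z (t : R) : P x -> P y -> P z -> 0 <= t <= 1 ->
  y = x + t *: (z - x) -> log_view P (theta i) x <= log_view P (theta i) z ->
  log_view P (theta i) x <= log_view P (theta i) y <= log_view P (theta i) z.
Proof.
move=> Px Py Pz t01 yE; rewrite !log_view_mono //.
exact: (cotview_between (theta_circle i) (PD Px) (PD Pz) t01 yE).
Qed.

Lemma polygon_dist_segment x y z : P x -> P y -> P z -> segment x z y ->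
  d x z = d x y + d y z.
Proof.
move=> Px Py Pz [t t01 yE]; rewrite /d /polygon_dist -/(term x z) -/(term x y) -/(term y z).
rewrite -lim_seriesD; [|exact: cvg_term|exact: cvg_term].
congr (limn (series _)); apply/funext => i /=.
rewrite /term -[RHS]mulrDr; congr (_ * _); rewrite !d_theta_log_view //.
set a := log_view _ _ x; set b := log_view _ _ y; set c := log_view _ _ z.
have [ac|/ltW ca] := leP a c.
  have /andP[ab bc] := log_view_between Px Py Pz t01 yE ac.
  by rewrite !ler0_norm ?subr_le0 //; lra.
have t01' : 0 <= 1 - t <= 1 by lra.
have yE' : y = z + (1 - t) *: (x - z) by rewrite yE; pt_eq ltac:(ring).
have /andP[cb ba] := log_view_between Pz Py Px t01' yE' ca.
by rewrite !ger0_norm ?subr_ge0 //; lra.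
Qed.

(** The defects in the triangle inequalities of the terms are nonnegative with sum zero; as the
    weights are positive, each defect vanishes. *)
Lemma polygon_dist_between i x y z : P x -> P y -> P z ->
  d x z = d x y + d y z -> let c := cotview (theta i) in
  c x <= c y <= c z \/ c z <= c y <= c x.
Proof.
move=> Px Py Pz dE.
have e0 : term x z i = term x y i + term y z i.
  pose u := term x y + term y z - term x z.
  have u0 n : 0 <= u n.
    rewrite /u /term subr_ge0 -[leRHS]mulrDr ler_wpM2l ?(ltW (w_gt0 n)) //.
    by rewrite !d_theta_log_view // ler_distD.
  have cu : cvgn (series (term x y + term y z)).
    by apply: is_cvg_seriesD; exact: cvg_term.
  have := series_term_le i u0 (is_cvg_seriesB cu (cvg_term Px Pz)).
  rewrite lim_seriesB // ?lim_seriesD //; try exact: cvg_term.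
  move: dE; rewrite /d /polygon_dist -/(term x z) -/(term x y) -/(term y z) => <-.
  rewrite subrr => ui; apply/eqP; rewrite eq_sym -subr_eq0.
  by rewrite eq_le ui; exact: u0.
move: e0; rewrite /term -mulrDr => /(mulfI (lt0r_neq0 (w_gt0 i))).
by rewrite !d_theta_log_view // -!log_view_mono // => /dist_between.
Qed.

(* A theta_i close to a line separating [y] from [x] and [z] sees [y] outside
   of the angle spanned by [x] and [z], which makes its term strict. *)
Lemma segment_polygon_dist x y z : P x -> P y -> P z ->
  d x z = d x y + d y z -> segment x z y.
Proof.
move=> Px Py Pz dE; apply: contrapT => /separate_segment[g [gx gz]].
have btw i := polygon_dist_between i Px Py Pz dE; clear dE.
have gxp : 0 < dot g (x - y) by lra.
(* Places [q] in [P] at level one half of [g], between [y] at level 0 and [x], [z] at levels at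
   least 1. *)
pose s := (2 * dot g (x - y))^-1.
have s01 : 0 <= s <= 1 by rewrite invr_ge0 invf_le1; lra.
pose q := y + s *: (x - y).
have dq : unit_disk q by apply: PD; exact: convex_lerp.
have gq : dot g (q - y) = 2^-1.
  rewrite (_ : dot _ _ = s * dot g (x - y)).
    by rewrite /s; field; rewrite gt_eqF.
  by rewrite /q /dot /= /GRing.scale /=; ring.
have n0 : ((- g.2, g.1) : R * R) <> 0.
  case=> /eqP; rewrite oppr_eq0 => /eqP g2 g1.
  by move: gx; rewrite /dot g1 g2 !mul0r addr0 ler10.
have [t [_ [_ ct _ _]]] := line_circle dq n0.
set th0 := q + t *: _ in ct.
have g0 : dot g (th0 - y) = 2^-1.
  by rewrite -gq /th0 /dot /= /GRing.scale /=; ring.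
(* On the ball of radius [(4 * M)^-1] for the sup norm, [g] varies by less than one quarter, which
   preserves the separation. *)
pose M := 1 + `|g.1| + `|g.2|.
have M0 : 0 < M by rewrite /M -addrA ltr_pwDl // addr_ge0.
have e0 : 0 < (4 * M)^-1 by rewrite invr_gt0 mulr_gt0.
have [_ [[i _ <-] thi]] := theta_dense ct (nbhsx_ballx th0 _ e0).
have gi : `|dot g (theta i - th0)| < 4^-1.
  case: thi => /= b1 b2; rewrite /ball /= in b1 b2.
  have m1 : `|g.1 * ((theta i).1 - th0.1)| <= `|g.1| * (4 * M)^-1.
    by rewrite normrM ler_wpM2l // distrC ltW.
  have m2 : `|g.2 * ((theta i).2 - th0.2)| <= `|g.2| * (4 * M)^-1.
    by rewrite normrM ler_wpM2l // distrC ltW.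
  apply: (le_lt_trans (ler_normD _ _)) => /=.
  apply: (le_lt_trans (lerD m1 m2)); rewrite -mulrDl ltr_pdivrMr ?mulr_gt0 //.
  by rewrite /M; lra.
move: gi; rewrite ltr_norml => /andP[gi1 gi2].
have split_g u : dot g (u - theta i) = dot g (u - y) - dot g (theta i - th0) - dot g (th0 - y).
  by rewrite /dot /=; ring.
have fx : 0 < dot g (x - theta i) by rewrite split_g g0; lra.
have fz : 0 < dot g (z - theta i) by rewrite split_g g0; lra.
have fy : dot g (y - theta i) < 0.
  by rewrite split_g g0 subrr [dot g 0](_ : _ = 0); [lra|rewrite /dot /=; ring].
have thc := theta_circle i.
move: fx fy fz.
rewrite !(dot_cotview g thc) //; try exact: PD.
rewrite !pmulr_rgt0 ?pmulr_rlt0; try by apply: (disk_dot_lt1 thc); exact: PD.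
(* An affine function of the cotangent cannot be positive at [x] and [z] and negative at [y], whose
   cotangent lies between theirs. *)
set al := dot g _; set be := dot g _ => fx fy fz.
case: (btw i) => /= /andP[h1 h2]; have [al0|al0] := leP 0 al.
- have := ler_wpM2r al0 h1; lra.
- have := ler_wnM2r (ltW al0) h2; lra.
- have := ler_wpM2r al0 h1; lra.
- have := ler_wnM2r (ltW al0) h2; lra.
Qed.

Lemma open_segment_closure s p : s \in sides -> open_segment s.1 s.2 p ->
  closure P p.
Proof.
move=> ss [mu /andP[mu0 mu1] pE]; apply: (side_boundary hP ss _).1.
by exists mu => //; rewrite !ltW.
Qed.

Lemma side_approach s x p (e : R) : s \in sides -> P x ->
  open_segment s.1 s.2 p -> 0 < e <= 1 -> P (p + e *: (x - p)).
Proof.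
move=> ss Px op e01; have clp := open_segment_closure ss op.
have e01' : 0 <= 1 - e < 1 by lra.
have := interior_closure oP cP Px clp e01'; congr (P _).
by pt_eq ltac:(ring).
Qed.

(** The two approaching points use the same weights [1 - e] and [e], so it suffices to compare [p']
    with [p] and [x'] with [x]. *)
Lemma side_comparable s x x' p p' : s \in sides -> P x -> P x' ->
  open_segment s.1 s.2 p -> open_segment s.1 s.2 p' ->
  exists2 k : R, 0 < k & forall e : R, 0 < e <= 1 ->
    forall l, is_affine l -> (forall u, P u -> 0 <= l u) ->
    l (p' + e *: (x' - p')) <= k * l (p + e *: (x - p)).
Proof.
move=> ss Px Px' [mu /andP[mu0 mu1] pE] [nu /andP[nu0 nu1] pE'].
have [k2 k21 h2] := affine_comparable x' oP Px.
have m0 : 0 < mu^-1 by rewrite invr_gt0.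
have m0' : 0 < (1 - mu)^-1 by rewrite invr_gt0 subr_gt0.
(* [l p] is at least [(1 - mu) * l s.1] and at least [mu * l s.2], while [l p'] is at most
   [l s.1 + l s.2]. *)
pose k1 := mu^-1 + (1 - mu)^-1.
exists (k1 + k2); first by rewrite /k1; lra.
move=> e /andP[e0 e1] l al l0.
have [sv sw] := segment_ends s.1 s.2.
have lv := affine_closure_ge0 oP cP Px al l0 (side_boundary hP ss sv).1.
have lw := affine_closure_ge0 oP cP Px al l0 (side_boundary hP ss sw).1.
rewrite !al pE pE' !al; set v := l s.1 in lv *; set w' := l s.2 in lw *.
have lx := l0 _ Px; have := h2 l al l0; set X := l x in lx *; set X' := l x' => XX.
pose a := v + mu * (w' - v).
have a_ge : 0 <= a by rewrite /a; nra.
have va : v + nu * (w' - v) <= k1 * a.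
  have -> : k1 * a = v + w' + v * ((1 - mu) / mu) + w' * (mu / (1 - mu)).
    by rewrite /k1 /a; field; apply/andP; split; apply: lt0r_neq0; lra.
  have : 0 <= v * ((1 - mu) / mu) by rewrite !mulr_ge0 ?(ltW m0) //; lra.
  have : 0 <= w' * (mu / (1 - mu)) by rewrite !mulr_ge0 ?(ltW m0') //; lra.
  have : 0 <= v * nu by rewrite mulr_ge0 // ltW.
  have : 0 <= w' * (1 - nu) by rewrite mulr_ge0 //; lra.
  by lra.
rewrite -/a; set a' := v + nu * _ in va *.
have k10 : 0 < k1 by rewrite /k1; lra.
have e1' : 0 <= 1 - e by lra.
have q1 : (1 - e) * a' <= (1 - e) * (k1 * a) by rewrite ler_wpM2l.
have q2 : e * X' <= e * (k2 * X) by rewrite ler_wpM2l // ltW.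
have q3 : 0 <= (1 - e) * (k2 * a) by rewrite !mulr_ge0 //; lra.
have q4 : 0 <= e * (k1 * X) by rewrite !mulr_ge0 // ltW.
lra.
Qed.

Lemma side_bounded s x x' p p' : s \in sides -> P x -> P x' ->
  open_segment s.1 s.2 p -> open_segment s.1 s.2 p' ->
  exists D : R, forall e : R, 0 < e <= 1 ->
    d (p + e *: (x - p)) (p' + e *: (x' - p')) <= D.
Proof.
move=> ss Px Px' op op'.
have [k1 k10 h1] := side_comparable ss Px Px' op op'.
have [k2 k20 h2] := side_comparable ss Px' Px op' op.
have [K K0 HK] := d_theta_le_comparable.
pose M := ln ((K * (k1 + k2)) ^+ 2).
exists (limn (series (fun i => w i * M))) => e e01.
have Pz := side_approach ss Px op e01; have Pz' := side_approach ss Px' op' e01.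
apply: lim_series_le; [exact: cvg_term|exact: cvg_scaled|move=> i].
rewrite ler_wpM2l ?(ltW (w_gt0 i)) //; apply: HK => //; first by lra.
move=> l al l0; have := h1 e e01 l al l0; have := h2 e e01 l al l0.
have := l0 _ Pz; have := l0 _ Pz'.
set a := l _; set b := l (p + _) => a0 b0 ha hb.
have : 0 <= k1 * a by rewrite mulr_ge0 // ltW.
have : 0 <= k2 * b by rewrite mulr_ge0 // ltW.
by move=> *; split; lra.
Qed.

(** From an end [th] of the chord the side is seen edge-on and [P] lies on one side of its line, so
    [p] is extreme for [cotview th] and the term of [th] alone diverges. *)
Lemma side_far s x p (N : R) : s \in sides -> P x -> open_segment s.1 s.2 p ->
  exists2 e0 : R, 0 < e0 & forall e, 0 < e < e0 -> N < d x (p + e *: (x - p)).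
Proof.
move=> ss Px op; have [_ [sidesD _]] := hP.
have [dv dw vw] := sidesD _ ss.
have n0 : s.2 - s.1 <> 0 by move/eqP; rewrite subr_eq0 => /eqP /esym.
have [t1 [t2 [t12 c1 c2 tD]]] := line_circle dv n0.
have /andP[a1 a2] : t1 < 0 < t2 by apply: tD; rewrite scale0r addr0.
have /andP[b1 b2] : t1 < 1 < t2 by apply: tD; rewrite scale1r addrC subrK.
set th := s.1 + t1 *: _ in c1; set th' := s.1 + t2 *: _ in c2.
have tt : t2 - t1 != 0 by apply: lt0r_neq0; lra.
have thn : th <> th'.
  move=> e; have : (t2 - t1) *: (s.2 - s.1) = 0.
    by rewrite scalerBl; apply/eqP; rewrite subr_eq0 -(inj_eq (addrI s.1)); apply/eqP.
  by move=> /eqP; rewrite scaler_eq0 (negPf tt) => /eqP.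
have sub : segment s.1 s.2 `<=` chord th th'.
  move=> _ [m /andP[m0 m1] ->]; exists ((m - t1) / (t2 - t1)).
    by rewrite divr_ge0 ?ler_pdivrMr; lra.
  by rewrite /th /th'; pt_eq ltac:(field; exact: tt).
have [[i _ ithE] _] := theta_sides ss c1 c2 thn sub.
have [r [r0 r1 Pr]] := polygon_radius hP.
have Pr' u : P u -> dot u u <= r ^+ 2.
  by move=> Pu; apply: Pr; exact: subset_closure.
have pr : dot p p <= r ^+ 2 by apply: Pr; exact: open_segment_closure op.
have dp : unit_disk p by exact: inner_disk pr.
have [mu /andP[mu0 mu1] pE] := op.
have side : (forall u, P u -> cotview th u < cotview th p) \/
            (forall u, P u -> cotview th p < cotview th u).
  have cE u : P u -> (mu - t1) * crossp (s.2 - s.1) (u - s.1) =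
      (1 - dot p th) * (1 - dot u th) * (cotview th p - cotview th u).
    move=> Pu; rewrite -crossp_cotview //; last exact: PD.
    by rewrite pE /th /crossp /= /GRing.scale /=; ring.
  have mt : 0 < mu - t1 by lra.
  have pos u : P u -> 0 < (1 - dot p th) * (1 - dot u th).
    by move=> Pu; rewrite mulr_gt0 // disk_dot_lt1 //; exact: PD.
  case: (side_sign hP ss) => sg; [left|right] => u Pu.
    have : 0 < (mu - t1) * crossp (s.2 - s.1) (u - s.1) by rewrite mulr_gt0 ?sg.
    by rewrite cE // pmulr_rgt0 ?pos // subr_gt0.
  have : (mu - t1) * crossp (s.2 - s.1) (u - s.1) < 0 by rewrite pmulr_rlt0 ?sg.
  by rewrite cE // pmulr_rlt0 ?pos // subr_lt0.
have Pe e : 0 < e <= 1 -> P (p + e *: (x - p)) by apply: (side_approach ss Px op).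
(* Dividing by [w i] compensates the weight of this term in the sum. *)
have [e0 e00 He] := d_theta_far P0 oP r1 r0 Pr' c1 (N / w i) Px pr Pe side.
exists (Num.min e0 1); first by rewrite lt_min e00 ltr01.
move=> e /andP[ep]; rewrite lt_min => /andP[ee e1].
have Pz : P (p + e *: (x - p)) by apply: Pe; rewrite ep ltW.
apply: (lt_le_trans _ (term_le i Px Pz)).
rewrite /term ithE mulrC -ltr_pdivrMr //; apply: He; last exact: ltW.
by rewrite ep.
Qed.

Lemma polygon_horizon_side s : s \in sides -> horizon_side P d s.1 s.2.
Proof.
move=> ss; split.
- by move=> x p e; exact: side_approach.
- by move=> x x' p p'; exact: side_bounded.
- by move=> x p N; exact: side_far.
Qed.

End PolygonDistance.

Theorem theorem11 (R : realType) (P : set (R * R))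
    (sides : seq ((R * R) * (R * R))) (theta : nat -> R * R) (w : nat -> R)
    (hP : convex_polygon P sides)
    (theta_circle : forall i, unit_circle (theta i))
    (theta_dense : @unit_circle R `<=` closure (range theta))
    (theta_sides : side_chords_in (range theta) sides)
    (w_gt0 : forall i, 0 < w i)
    (w_sum : cvgn (series w))
    (U : set (R * R)) (hU : convex_domain U) :
  ~ isometric P (polygon_dist P theta w) U (hilbert_dist U).
Proof.
move=> [f [bij isom]]; have [_ oU cU _] := hU.
have [x [y [z [s1 [s2 [[Px Py Pz xz nseg] [ss1 ss2 [r1 r2] [r1' r2']]]]]]]] :=
  polygon_triangle hP.
have hs1 := polygon_horizon_side hP theta_circle theta_sides w_gt0 w_sum ss1.
have hs2 := polygon_horizon_side hP theta_circle theta_sides w_gt0 w_sum ss2.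
apply: nseg; apply: (isometry_segment_of_sides oU cU bij isom _ hs1 hs2) => //.
- move=> x' y' z' Px' Py' Pz'; split.
    exact: (segment_polygon_dist hP theta_circle theta_dense w_gt0 w_sum).
  exact: (polygon_dist_segment hP theta_circle w_gt0 w_sum).
- exact: ray_hits_trans r1 r2.
- exact: ray_hits_trans r1' r2'.
Qed.
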